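(* For every $\beta$ with $\bar\beta_d<\beta<\beta_c$ there exist $0<\underline{q}<\overline{q}<1$ depending on $\beta$ and $\xi$, and $c=c(\beta,\xi)>0$, such that for all sufficiently large $N$ $$\mathbb{E}\,\mu_{\beta,\bm{G}}\Big(\Big\{\bm{\sigma}\in\{-1,+1\}^N:\exists\,\bm{\sigma}'\in\{-1,+1\}^N\ \text{s.t.}\ H_N(\bm{\sigma}')\ge\beta\xi(1)N,\ \underline{q}\le\langle\bm{\sigma},\bm{\sigma}'\rangle/N\le\overline{q}\Big\}\Big)\le e^{-cN}.$$
   Context: Fix an integer $P\ge2$ and real scalars $(\gamma_k)_{k=2}^P$, not all zero, and let $\xi(x)=\sum_{k=2}^P\gamma_k^2x^k$ (the mixture). Let $\bm{G}=(g_{i_1,\dots,i_k})_{1\le i_1,\dots,i_k\le N,\;2\le k\le P}$ be i.i.d. $N(0,1)$. The Hamiltonian is $$H_N(\bm{\sigma})=\sum_{k=2}^P\frac{\gamma_k}{N^{(k-1)/2}}\sum_{1\le i_1,\dots,i_k\le N}g_{i_1,\dots,i_k}\sigma_{i_1}\cdots\sigma_{i_k},\qquad\bm{\sigma}\in\{-1,+1\}^N,$$ and the Gibbs measure is $\mu_{\beta,\bm{G}}(\bm{\sigma})=e^{\beta H_N(\bm{\sigma})}/Z_N(\beta)$ with $Z_N(\beta)=\sum_{\bm{\sigma}\in\{-1,+1\}^N}e^{\beta H_N(\bm{\sigma})}$. The expectation $\mathbb{E}$ is over $\bm{G}$. The critical inverse temperature $\beta_c$ is the largest $\beta$ for which $\lim_{N\to\infty}\frac1N\mathbb{E}\log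 Z_N(\beta)=\beta^2\xi(1)/2+\log 2$. With $\varphi$ and $\Phi$ the density and cumulative distribution function of the standard normal distribution, $$\bar\beta_d=\inf_{q\in(0,1)}\frac{2\sqrt{\xi'(1)}\,\varphi\big(\Phi^{-1}\big(\frac{1+q}{2}\big)\big)}{\xi(1)-\xi(q)}.$$ *)

(* Defs.v *)
From HB Require Import structures.
From mathcomp Require Import all_boot all_order all_algebra.
From mathcomp Require Import all_classical all_reals all_analysis.

Set Implicit Arguments.
Unset Strict Implicit.
Unset Printing Implicit Defensive.

Import Order.TTheory GRing.Theory Num.Theory.
Import numFieldNormedType.Exports.

Local Open Scope classical_set_scope.
Local Open Scope ring_scope.

Definition mutually_independent (R : realType) (d : measure_display)
    (T : measurableType d) (Pr : probability T R) (I : eqType) (A : set I)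
    (X : I -> {RV Pr >-> R}) : Prop :=
  forall (J : seq I) (B : I -> set R),
    uniq J -> (forall i, i \in J -> A i /\ measurable (B i)) ->
    Pr (\bigcap_(i in [set` J]) (X i @^-1` B i)) =
      (\prod_(i <- J) Pr (X i @^-1` B i))%E.

Definition iid_standard_normal (R : realType) (d : measure_display)
    (T : measurableType d) (Pr : probability T R) (I : eqType) (A : set I)
    (X : I -> {RV Pr >-> R}) : Prop :=
  (forall i, A i -> forall B : set R, measurable B ->
     distribution Pr (X i) B = normal_prob 0 1 B) /\
  mutually_independent A X.

(* A realization of the disorder G for N sites. The multi-index (i_1,...,i_k)
   is a sequence of length k, so the couplings of all orders form one family;
   nothing is assumed (and nothing is used) outside 2 <= k <= P. *)
Record disorder (R : realType) (P N : nat) := Disorder {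
  disorder_display : measure_display;
  disorder_space : measurableType disorder_display;
  disorder_prob : probability disorder_space R;
  coupling : seq 'I_N -> {RV disorder_prob >-> R};
  coupling_iid :
    iid_standard_normal [set i | (2 <= size i <= P)%N] coupling }.

Section Model.
Context {R : realType} (P : nat) (gamma : nat -> R).

Definition mixture : {poly R} := \sum_(2 <= k < P.+1) gamma k ^+ 2 *: 'X^k.

(* {-1, +1}^N, with true standing for the spin -1. *)
Definition config (N : nat) := {ffun 'I_N -> bool}.

Definition spin {N : nat} (s : config N) (i : 'I_N) : R := (-1) ^+ s i.

Definition inner {N : nat} (s t : config N) : R := \sum_(i < N) spin s i * spin t i.

Section FixedCouplings.
Context {N : nat} (g : seq 'I_N -> R).

Definition hamiltonian (s : config N) : R :=
  \sum_(2 <= k < P.+1) gamma k / N%:R `^ ((k%:R - 1) / 2) *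
    \sum_(i : k.-tuple 'I_N) g i * \prod_(j <- i) spin s j.

Definition partition_function (beta : R) : R :=
  \sum_(s : config N) expR (beta * hamiltonian s).

Definition gibbs (beta : R) (A : {set config N}) : R :=
  \sum_(s in A) expR (beta * hamiltonian s) / partition_function beta.

(* Configurations whose overlap with some configuration of energy at least
   beta xi(1) N lies in [ql, qu]. *)
Definition overlap_event (beta ql qu : R) : {set config N} :=
  finset (fun s : config N => [exists t : config N,
    (beta * mixture.[1] * N%:R <= hamiltonian t) &&
    (ql <= inner s t / N%:R <= qu)]).

End FixedCouplings.

Section Expectations.
Context {N : nat} (G : disorder R P N).

Definition free_energy (beta : R) : \bar R :=
  ((N%:R^-1)%:E * 'E_(disorder_prob G)[fun w =>
     ln (partition_function (fun i => coupling G i w) beta)])%E.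

Definition expected_gibbs_overlap (beta ql qu : R) : \bar R :=
  'E_(disorder_prob G)[fun w =>
    let g i := coupling G i w in gibbs g beta (overlap_event g beta ql qu)].

End Expectations.

(* The free energy depends on the disorder only through its law, which is
   fixed, so quantifying over all realizations does not restrict beta. *)
Definition annealed_temperatures : set R :=
  [set beta | forall G : forall N : nat, disorder R P N,
     (fun N => free_energy (G N) beta) @ \oo -->
       (beta ^+ 2 * mixture.[1] / 2 + ln 2)%:E].

Definition is_beta_c (bc : R) : Prop :=
  annealed_temperatures bc /\ ubound annealed_temperatures bc.

Definition Phi (x : R) : R := fine (normal_prob 0 1 `]-oo, x]).

Definition Phi_inv : R -> R := pinv setT Phi.

Definition beta_d_bar : R :=
  inf [set 2 * Num.sqrt (mixture^`()).[1] *
             normal_pdf 0 1 (Phi_inv ((1 + q) / 2)) /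
             (mixture.[1] - mixture.[q]) | q in `]0, 1[%classic].

End Model.

(* Main.v *)
(* Since [beta < beta_c], the expectation of [ln Z] at [beta] is at least its annealed value
   up to [o(N)] (interpolate from [beta_c]), and by Gaussian concentration [Z] itself is below
   [exp(N (beta^2 xi(1) / 2 + ln 2 - 3 e))] with exponentially small probability only. Outside
   this event the Gibbs average is bounded by a first moment: with [A s] the slice of overlaps
   in [[q - h, q + h]] and [lam > 0] small, it suffices to bound, for each [s],
     E exp(beta H(s) + lam (max_(t in A s) H(t) - beta xi(1) N)).
   The tilt by [exp(beta H(s))] plants [s], shifting the mean of [H(t)] to
   [beta N xi(<s, t> / N) <= beta N xi(q + h)]. The remaining centered maximum is compared with
   that of a linear field with variance [xi'(1)] per site, which a Lagrange multiplier [b] for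
   the overlap constraint bounds by [N sqrt(xi'(1)) (E|g - b| - b (q - h))]. For [2 Phi(b) - 1 = q]
   one has [E|g - b| = 2 phi(b) + b q], so the exponent is negative as soon as
   [2 sqrt(xi'(1)) phi(b) < beta (xi(1) - xi(q))], and such a [q] exists by [beta_d_bar < beta]. *)
Require Import Defs.
From HB Require Import structures.
From mathcomp Require Import all_boot all_order all_algebra.
From mathcomp Require Import all_classical all_reals all_analysis.
From mathcomp Require Import measurable_realfun gauss_integral normal_distribution.
From mathcomp Require Import ring lra.
Set Implicit Arguments.
Unset Strict Implicit.
Unset Printing Implicit Defensive.
Import Order.TTheory GRing.Theory Num.Theory.
Import numFieldNormedType.Exports.
Local Open Scope classical_set_scope.
Local Open Scope ring_scope.

(** The disorder enters only through fields [e + sum_w g_w a_w] on the configurations, with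
    independent standard Gaussians [g_w]. Expectations of nonnegative functionals of such a field
    are rewritten as iterated one-dimensional Gaussian averages; concentration, interpolation in the
    temperature, planting and the comparison of maxima are then each proved for a single Gaussian
    and extended by induction on the list of directions. The averages may be infinite, so
    functionals are kept nonnegative and Tonelli allows any reordering. The variance [xi'(1)] has
    the following origin. The Gaussian of a monomial of degree [k] is replaced by [k] independent
    ones of the same strength, one per factor, which makes the field linear in the spins. Site [i]
    then collects the squared strength of each monomial as many times as [i] occurs in it, in total
    [xi'(1)]. For a linear field the exponential of the maximum over a slice is bounded by a product
    over the sites, and only a one-dimensional integral remains. *)

Definition mfun_of d d' (T : measurableType d) (T' : measurableType d') (f : T -> T')
  (mf : measurable_fun setT f) : {mfun T >-> T'} := HB.pack f (isMeasurableFun.Build _ _ _ _ f mf).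

(** * One-dimensional Gaussian integrals: affine changes of variable, tilting, convolution *)

Section normal_integral.
Context {R : realType}.
Local Notation mu := (@lebesgue_measure R).
Local Open Scope ereal_scope.

Lemma ge0_integral_normal_prob (m s : R) (f : R -> \bar R) : s != 0%R ->
  measurable_fun [set: R] f -> (forall x, 0 <= f x) ->
  \int[normal_prob m s]_x f x = \int[mu]_x (f x * (normal_pdf m s x)%:E).
Proof.
move=> s0 mf f0.
have dom := @normal_prob_dominates R m s.
rewrite -(@Radon_Nikodym_SigmaFinite.change_of_variables _ _ _ (normal_prob m s) mu dom)//.
have If := Radon_Nikodym_SigmaFinite.f_integrable dom.
apply: ae_eq_integral => //.
- by apply: emeasurable_funM => //; exact: (measurable_int mu).
- apply: emeasurable_funM => //=; apply/measurableT_comp => //=.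
  by apply/measurable_funTS; exact: measurable_normal_pdf.
apply: ae_eqe_mul2l => /=.
apply: integral_ae_eq => //=.
  by apply/measurable_funTS/measurableT_comp =>//; exact: measurable_normal_pdf.
by move=> E _ mE; rewrite -Radon_Nikodym_SigmaFinite.f_integral.
Qed.

(** By uniqueness of Lebesgue measure: the rescaled image measure gives each interval []a, b]] its
    length. *)
Lemma lebesgue_measure_affine (m s : R) (A : set R) : (0 < s)%R -> measurable A ->
  mu A = s%:E * mu ((fun y => m + s * y)%R @^-1` A).
Proof.
move=> s0 mA.
have mphi : measurable_fun setT (fun y : measurableTypeR R => m + s * y : measurableTypeR R)%R.
  by apply: measurable_funD => //; exact: measurable_funM.
pose phi := mfun_of mphi.
have s0' : (0 <= s)%R by exact: ltW.
pose nu := mscale (NngNum s0') (pushforward mu phi).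
rewrite (@lebesgue_measure_unique _ (nu mphi))//.
move=> _ [[a b]] _ <-.
rewrite /nu /mscale/= /pushforward/=.
rewrite (_ : mscale _ _ _ = s%:E * mu `]((a - m) / s)%R, ((b - m) / s)%R]%classic); last first.
  rewrite /mscale/=; congr (_ * mu _).
  apply/seteqP; split=> x /=; rewrite !in_itv/= ltr_pdivrMr// ler_pdivlMr//;
    by rewrite ltrBlDr lerBrDr ![(x * s)%R]mulrC ![(m + _)%R]addrC.
rewrite !lebesgue_measure_itv/= !lte_fin.
rewrite ltr_pM2r ?invr_gt0// ltrD2r; case: ifP => ab; last by rewrite mule0.
by rewrite -!EFinB -EFinM; congr EFin; field; rewrite gt_eqF.
Qed.

Lemma ge0_integral_affine (m s : R) (f : R -> \bar R) : (0 < s)%R ->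
  measurable_fun [set: R] f -> (forall x, 0 <= f x) ->
  \int[mu]_x f x = s%:E * \int[mu]_x f (m + s * x)%R.
Proof.
move=> s0 mf f0.
have mphi : measurable_fun setT (fun y : measurableTypeR R => m + s * y : measurableTypeR R)%R.
  by apply: measurable_funD => //; exact: measurable_funM.
pose phi := mfun_of mphi.
have s0' : (0 <= s)%R by exact: ltW.
have -> : \int[mu]_x f (m + s * x)%R = \int[pushforward mu phi]_x f x.
  by rewrite ge0_integral_pushforward//= preimage_setT.
rewrite -[s in RHS]/((NngNum s0')%:num).
rewrite -ge0_integral_mscale//.
apply: eq_measure_integral => A mA _ /=.
by rewrite (lebesgue_measure_affine m s0 mA) /mscale.
Qed.

Lemma ge0_integral_oppr (f : R -> \bar R) :
  measurable_fun [set: R] f -> (forall x, 0 <= f x) ->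
  \int[mu]_x f x = \int[mu]_x f (- x)%R.
Proof.
move=> mf f0.
have mN : measurable_fun setT (-%R : measurableTypeR R -> measurableTypeR R) by exact: oppr_measurable.
have -> : \int[mu]_x f (- x)%R = \int[pushforward mu (-%R : measurableTypeR R -> measurableTypeR R)]_x f x.
  by rewrite ge0_integral_pushforward//= preimage_setT.
pose nu : {measure set _ -> \bar R} := measure_function_pushforward__canonical__measure_function_Measure mu mN.
rewrite -[RHS]/(\int[nu]_x f x).
apply: eq_measure_integral => A mA _ /=.
by rewrite -lebesgue_measureN.
Qed.

(** Locked so that the measure stays opaque to conversion; only [std_normalE] and
    [ge0_integral_std_normal] open it. *)
Definition std_normal : probability (measurableTypeR R) R :=
  locked (normal_prob (0:R) 1 : probability (measurableTypeR R) R).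

Lemma std_normalE (A : set R) : std_normal A = normal_prob 0 1 A.
Proof. by rewrite /std_normal -lock. Qed.

Local Notation gam := std_normal.

Lemma ge0_integral_std_normal (f : R -> \bar R) :
  measurable_fun [set: R] f -> (forall x, 0 <= f x) ->
  \int[gam]_x f x = \int[mu]_x (f x * (normal_pdf 0 1 x)%:E).
Proof.
by move=> mf f0; rewrite /std_normal -lock; apply: ge0_integral_normal_prob; first exact: oner_neq0.
Qed.

Lemma integral_std_normal_cst (r : \bar R) : \int[gam]_x r = r.
Proof. transitivity (r * gam setT); first exact: integral_cst.
by rewrite [X in _ * X](probability_setT gam) mule1. Qed.

Lemma ge0_integral_std_normal_oppr (f : R -> \bar R) :
  measurable_fun [set: R] f -> (forall x, 0 <= f x) ->
  \int[gam]_x f (- x)%R = \int[gam]_x f x.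
Proof.
move=> mf f0.
have mfN : measurable_fun [set: R] (fun x => f (- x)%R) by apply: measurableT_comp.
have mp := @measurable_normal_pdf R 0 1.
have p0 := @normal_pdf_ge0 R 0 1.
rewrite !ge0_integral_std_normal//.
rewrite [RHS]ge0_integral_oppr; last 2 first.
- by apply: emeasurable_funM => //; apply/measurableT_comp.
- by move=> x; rewrite mule_ge0// lee_fin.
apply: eq_integral => x _; congr (_ * _%:E).
by rewrite !normal_pdfE//= /normal_fun !subr0 sqrrN.
Qed.

Lemma ge0_integral_normal_prob_affine (m s : R) (f : R -> \bar R) : (0 < s)%R ->
  measurable_fun [set: R] f -> (forall x, 0 <= f x) ->
  \int[gam]_x f (m + s * x)%R = \int[normal_prob m s]_x f x.
Proof.
move=> s0 mf f0.
have s0' : s != 0%R by rewrite gt_eqF.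
have mf' : measurable_fun [set: R] (fun x => f (m + s * x)%R).
  by apply: measurableT_comp => //; apply: measurable_funD => //; exact: measurable_funM.
have mp m' s' := @measurable_normal_pdf R m' s'.
have p0 m' s' := @normal_pdf_ge0 R m' s'.
rewrite ge0_integral_std_normal; [|exact: mf'|by []].
rewrite ge0_integral_normal_prob; [|exact: s0'|exact: mf|by []].
rewrite [RHS](ge0_integral_affine m s0); last 2 first.
- by apply: emeasurable_funM => //; apply/measurableT_comp.
- by move=> x; rewrite mule_ge0// lee_fin.
rewrite -ge0_integralZl//; last 3 first.
- by apply: emeasurable_funM => //; apply/measurableT_comp => //; apply/measurableT_comp => //; apply: measurable_funD => //; exact: measurable_funM.
- by move=> x _; rewrite mule_ge0// lee_fin.
- by rewrite lee_fin ltW.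
apply: eq_integral => x _; rewrite muleCA -EFinM; congr (_ * _%:E).
rewrite !normal_pdfE//= /normal_fun /normal_peak !subr0 mulrA; congr (_ * expR _)%R; last first.
  by rewrite addrC addKr; field.
rewrite expr1n mul1r -mulrnAr sqrtrM ?sqr_ge0// sqrtr_sqr gtr0_norm//.
by rewrite invfM mulrA divff// mul1r.
Qed.

(** Completing the square: [b x - x^2 / 2 = b^2 / 2 - (x - b)^2 / 2]. *)
Lemma ge0_integral_std_normal_shift (b : R) (f : R -> \bar R) :
  measurable_fun [set: R] f -> (forall x, 0 <= f x) ->
  \int[gam]_x ((expR (b * x))%:E * f x) = (expR (b ^+ 2 / 2))%:E * \int[gam]_x f (x + b)%R.
Proof.
move=> mf f0.
have mp m' s' := @measurable_normal_pdf R m' s'.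
have p0 m' s' := @normal_pdf_ge0 R m' s'.
have -> : \int[gam]_x f (x + b)%R = \int[gam]_x f (b + 1 * x)%R.
  by apply: eq_integral => x _; rewrite mul1r addrC.
have me : measurable_fun [set: R] (fun x => (expR (b * x))%:E).
  by apply/measurable_EFinP; apply: measurableT_comp => //; exact: measurable_funM.
have mfp : measurable_fun [set: R] (fun x => f x * (normal_pdf b 1 x)%:E).
  by apply: emeasurable_funM => //; apply/measurableT_comp.
rewrite ge0_integral_normal_prob_affine; [|exact: ltr01|exact: mf|by []].
rewrite ge0_integral_std_normal; last 2 first.
- exact: emeasurable_funM.
- by move=> x; rewrite mule_ge0// lee_fin expR_ge0.
rewrite ge0_integral_normal_prob; [|exact: oner_neq0|exact: mf|by []].
rewrite -ge0_integralZl; last 4 first.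
- exact: measurableT.
- exact: mfp.
- by move=> x _; rewrite mule_ge0// lee_fin.
- by rewrite lee_fin expR_ge0.
apply: eq_integral => x _; rewrite muleAC [RHS]muleCA [RHS]muleC -!EFinM; congr (_%:E * _).
rewrite !normal_pdfE//= /normal_fun mulrCA [RHS]mulrCA; congr (_ * _)%R.
by rewrite -!expRD; congr expR; field.
Qed.

Lemma integral_std_normal_expR (b : R) :
  \int[gam]_x (expR (b * x))%:E = (expR (b ^+ 2 / 2))%:E.
Proof.
have := @ge0_integral_std_normal_shift b (cst 1) (measurable_cst _) (fun=> lee01).
rewrite integral_std_normal_cst mule1 => <-.
by apply: eq_integral => x _; rewrite mule1.
Qed.

Lemma ge0_integral_std_normalD (a b : R) (f : R -> \bar R) :
  measurable_fun [set: R] f -> (forall x, 0 <= f x) ->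
  \int[gam]_x \int[gam]_y f (a * x + b * y)%R =
  \int[gam]_x f (Num.sqrt (a ^+ 2 + b ^+ 2) * x)%R.
Proof.
move=> mf f0.
wlog b0 : b / (0 <= b)%R.
  move=> H; have [|/ltW b0] := leP 0%R b; first exact: H.
  rewrite -(sqrrN b) -(H (- b)%R); last by rewrite oppr_ge0.
  apply: eq_integral => x _.
  rewrite -ge0_integral_std_normal_oppr.
  - by apply: eq_integral => y _; rewrite mulrN mulNr.
  - by apply: measurableT_comp => //; apply: measurable_funD => //; exact: measurable_funM.
  - by [].
have mp m' s' := @measurable_normal_pdf R m' s'.
have p0 m' s' := @normal_pdf_ge0 R m' s'.
move: b0; rewrite le_eqVlt => /predU1P[<-|b0].
  rewrite expr0n/= addr0 sqrtr_sqr.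
  transitivity (\int[gam]_x f (a * x)%R).
    apply: eq_integral => x _.
    under eq_integral do rewrite mul0r addr0.
    by rewrite integral_std_normal_cst.
  have [a0|a0] := ger0P a; first by [].
  rewrite -ge0_integral_std_normal_oppr.
  - by apply: eq_integral => y _; rewrite mulrN mulNr.
  - by apply: measurableT_comp => //; exact: measurable_funM.
  - by [].
set S := Num.sqrt _.
have S20 : (0 < a ^+ 2 + b ^+ 2)%R by rewrite ltr_wpDl ?sqr_ge0// exprn_gt0.
have S0 : (0 < S)%R by rewrite sqrtr_gt0.
have SE : (S ^+ 2 = a ^+ 2 + b ^+ 2)%R by rewrite sqr_sqrtr// ltW.
have b0' : b != 0%R by rewrite gt_eqF.
have S0' : S != 0%R by rewrite gt_eqF.
have -> : \int[gam]_x f (S * x)%R = \int[gam]_x f (0 + S * x)%R.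
  by apply: eq_integral => x _; rewrite add0r.
rewrite ge0_integral_normal_prob_affine; [|exact: S0|exact: mf|by []].
rewrite ge0_integral_normal_prob; [|exact: S0'|exact: mf|by []].
transitivity (\int[gam]_x \int[mu]_y (f y * (normal_pdf (a * x) b y)%:E)).
  apply: eq_integral => x _; rewrite ge0_integral_normal_prob_affine; [|exact: b0|exact: mf|by []].
  by rewrite ge0_integral_normal_prob; [|exact: b0'|exact: mf|by []].
have mpdf : measurable_fun [set: R * R] (fun z : R * R => normal_pdf (a * z.1) b z.2).
  rewrite (_ : (fun z => _) = (fun z : R * R => normal_peak b * expR (- (z.2 - a * z.1) ^+ 2 / (b ^+ 2 *+ 2)))%R); last first.
    by apply/funext => z; rewrite normal_pdfE.
  apply: measurable_funM => //; apply: measurableT_comp => //.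
  apply: measurable_funM => //; apply: measurableT_comp => //.
  apply: measurable_funX; apply: measurable_funB => //; apply: measurable_funM => //.
pose g (z : R * R) := f z.2 * (normal_pdf (a * z.1) b z.2)%:E.
have mg : measurable_fun setT g.
  apply: emeasurable_funM; first exact: measurableT_comp.
  exact/measurable_EFinP.
have g0 z : 0 <= g z by rewrite mule_ge0// lee_fin.
transitivity (\int[mu]_y \int[gam]_x g (x, y)); first exact: fubini_tonelli.
apply: eq_integral => z _; rewrite /g/=.
rewrite ge0_integralZl//; last 2 first.
- by apply/measurable_EFinP; exact: (measurableT_comp mpdf (measurable_pair2 z)).
- by move=> x _; rewrite lee_fin.
congr (_ * _).
rewrite ge0_integral_std_normal; last 2 first.
- by apply/measurable_EFinP; exact: (measurableT_comp mpdf (measurable_pair2 z)).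
- by move=> x; rewrite lee_fin.
(* The joint density factors as the marginal of [z], of variance [S^2], times the conditional
   density of [x] given [z], which integrates to 1. *)
transitivity (\int[mu]_x ((normal_pdf 0 S z)%:E * (normal_pdf (a * z / S ^+ 2) (b / S) x)%:E)); last first.
  rewrite ge0_integralZl; last 4 first.
  - exact: measurableT.
  - by apply/measurable_EFinP; exact: mp.
  - by move=> x _; rewrite lee_fin; exact: p0.
  - by rewrite lee_fin; exact: p0.
  by rewrite integral_normal_pdf mule1.
apply: eq_integral => x _; rewrite -!EFinM; congr EFin.
have bS0 : (b / S)%R != 0%R by rewrite mulf_neq0// invr_neq0.
rewrite !normal_pdfE// /normal_fun mulrACA [RHS]mulrACA; congr (_ * _)%R.
  rewrite /normal_peak -!invfM; congr (_^-1)%R.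
  rewrite -!sqrtrM; last 2 first.
  - by rewrite mulrn_wge0// mulr_ge0 ?sqr_ge0 ?pi_ge0.
  - by rewrite mulrn_wge0// mulr_ge0 ?sqr_ge0 ?pi_ge0.
  by congr Num.sqrt; field.
rewrite -!expRD; congr expR.
have -> : ((b / S) ^+ 2 = b ^+ 2 / (a ^+ 2 + b ^+ 2))%R by rewrite expr_div_n SE.
rewrite SE.
by field; rewrite b0' gt_eqF.
Qed.

End normal_integral.

(** * Iterated Gaussian averages of functionals of a field *)

Section gaussian_average.
Context {R : realType}.
Local Notation gam := (@std_normal R).
Local Open Scope ereal_scope.

(** Measurability is tested on all measurable families of fields, so [C -> R] needs no
    sigma-algebra. Quantifying over every parameter space [T] makes the notion stable under
    averaging: the Gaussian variable joins the parameters and Tonelli removes it. *)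
Definition measurable_functional (C : Type) (F : (C -> R) -> \bar R) : Prop :=
  forall d (T : measurableType d) (e : T -> C -> R),
    (forall c, measurable_fun [set: T] (fun x => e x c)) ->
    measurable_fun [set: T] (fun x => F (e x)).

Definition nonneg_functional (C : Type) (F : (C -> R) -> \bar R) : Prop :=
  measurable_functional F /\ forall e, 0 <= F e.

Section average.
Context {C : Type}.
Implicit Types (F G : (C -> R) -> \bar R) (a b e : C -> R).

Definition move_along e a (x : R) : C -> R := fun c => (e c + x * a c)%R.

Definition average a F e := \int[gam]_x F (move_along e a x).

(* [averages D F e] is the expectation of [F (e + \sum_(a <- D) g_a a)] for independent
   standard Gaussians [g_a]. *)
Definition averages (D : seq (C -> R)) F := foldr average F D.

Lemma measurable_move_along d (T : measurableType d) (f : T -> C -> R) a (g : T -> R) :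
  (forall c, measurable_fun [set: T] (fun x => f x c)) ->
  measurable_fun [set: T] g ->
  forall c, measurable_fun [set: T] (fun x => move_along (f x) a (g x) c).
Proof.
by move=> mf mg c; apply: measurable_funD => //; apply: measurable_funM.
Qed.

Lemma measurable_line F a e : measurable_functional F ->
  measurable_fun [set: R] (fun x => F (move_along e a x)).
Proof. by move=> mF; apply: mF => c; apply: measurable_move_along. Qed.

Lemma average_nonneg a F : nonneg_functional F -> nonneg_functional (average a F).
Proof.
move=> [mF F0]; split; last by move=> e; apply: integral_ge0 => x _; exact: F0.
move=> d T f mf.
pose g (z : T * R) := F (move_along (f z.1) a z.2).
have mg : measurable_fun setT g.
  apply: mF; apply: measurable_move_along => // c.
  exact: (measurableT_comp (mf c)).
exact: (@measurable_fun_fubini_tonelli_F _ _ _ (measurableTypeR R) R gam g mg (fun=> F0 _)).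
Qed.

Lemma averages_nonneg D F : nonneg_functional F -> nonneg_functional (averages D F).
Proof. by move=> nF; elim: D => //= a D IH; exact: average_nonneg. Qed.

Lemma averageC a b F : nonneg_functional F ->
  average a (average b F) = average b (average a F).
Proof.
move=> [mF F0]; apply/funext => e; rewrite /average.
pose g (z : R * R) := F (move_along (move_along e a z.1) b z.2).
have mg : measurable_fun setT g.
  by apply: mF; apply: measurable_move_along => //; apply: measurable_move_along.
transitivity (\int[gam]_y \int[gam]_x g (x, y)).
  by apply: (fubini_tonelli (m1 := gam) (m2 := gam)) => // z; exact: F0.
apply: eq_integral => y _; apply: eq_integral => x _; rewrite /g; congr F.
by apply/funext => c; rewrite /move_along/= addrAC.
Qed.

Lemma le_average a F G e : nonneg_functional F -> nonneg_functional G ->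
  (forall e', F e' <= G e') -> average a F e <= average a G e.
Proof.
move=> [mF F0] [mG G0] FG; apply: ge0_le_integral => //; by [exact: measurable_line|move=> x _].
Qed.

Lemma le_averages D F G e : nonneg_functional F -> nonneg_functional G ->
  (forall e', F e' <= G e') -> averages D F e <= averages D G e.
Proof.
move=> nF nG FG; elim: D e => [|a D IH] e /=; first exact: FG.
by apply: le_average => //; exact: averages_nonneg.
Qed.

Lemma averages_cat D E F : averages (D ++ E) F = averages D (averages E F).
Proof. by rewrite /averages foldr_cat. Qed.

Lemma averages_average D a F : nonneg_functional F ->
  averages D (average a F) = average a (averages D F).
Proof.
by move=> nF; elim: D => //= b D ->; rewrite averageC//; exact: averages_nonneg.
Qed.

Lemma averagesC D E F : nonneg_functional F ->
  averages D (averages E F) = averages E (averages D F).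
Proof.
move=> nF; elim: D => //= a D IH.
by rewrite IH averages_average//; exact: averages_nonneg.
Qed.

Lemma averageZ a F (k : R) e : nonneg_functional F -> (0 <= k)%R ->
  average a (fun e' => k%:E * F e') e = k%:E * average a F e.
Proof.
by move=> [mF F0] k0; rewrite /average ge0_integralZl//; exact: measurable_line.
Qed.

Lemma averagesZ D F (k : R) e : nonneg_functional F -> (0 <= k)%R ->
  averages D (fun e' => k%:E * F e') e = k%:E * averages D F e.
Proof.
move=> nF k0; elim: D e => //= a D IH e.
by rewrite (funext IH) averageZ//; exact: averages_nonneg.
Qed.

Lemma average_cst a (k : R) e : average a (fun=> k%:E) e = k%:E.
Proof. exact: integral_std_normal_cst. Qed.

Lemma nonneg_functional_cst (k : R) : (0 <= k)%R -> nonneg_functional (fun _ : C -> R => k%:E).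
Proof. by move=> k0; split=> // d T e _; exact: measurable_cst. Qed.

Lemma nonneg_functionalD F G : nonneg_functional F -> nonneg_functional G ->
  nonneg_functional (fun e => F e + G e).
Proof.
move=> [mF F0] [mG G0]; split; last by move=> e; rewrite adde_ge0.
by move=> d T e me; apply: emeasurable_funD; [exact: mF|exact: mG].
Qed.

Lemma nonneg_functionalM F G : nonneg_functional F -> nonneg_functional G ->
  nonneg_functional (fun e => F e * G e).
Proof.
move=> [mF F0] [mG G0]; split; last by move=> e; rewrite mule_ge0.
by move=> d T e me; apply: emeasurable_funM; [exact: mF|exact: mG].
Qed.

Lemma averageD a F G e : nonneg_functional F -> nonneg_functional G ->
  average a (fun e' => F e' + G e') e = average a F e + average a G e.
Proof.
by move=> [mF F0] [mG G0]; rewrite /average ge0_integralD//; exact: measurable_line.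
Qed.

Lemma averages_shift D F (h : C -> R) e :
  averages D F (e \+ h)%R = averages D (fun e' => F (e' \+ h)%R) e.
Proof.
elim: D e => //= a D IH e; rewrite /average; apply: eq_integral => x _.
by rewrite -IH; congr averages; apply/funext => c; rewrite /move_along/= addrAC.
Qed.

Lemma averageN a F : nonneg_functional F ->
  average (fun c => - a c)%R F = average a F.
Proof.
move=> [mF F0]; apply/funext => e; rewrite /average.
rewrite -[RHS]ge0_integral_std_normal_oppr//; last exact: measurable_line.
apply: eq_integral => x _; congr F; apply/funext => c.
by rewrite /move_along mulrN mulNr.
Qed.

Lemma average_merge a (r s : R) F : nonneg_functional F ->
  average (fun c => r * a c)%R (average (fun c => s * a c)%R F) =
  average (fun c => Num.sqrt (r ^+ 2 + s ^+ 2) * a c)%R F.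
Proof.
move=> [mF F0]; apply/funext => e; rewrite /average.
have := @ge0_integral_std_normalD R r s (fun x => F (move_along e a x)) (measurable_line a e mF) (fun=> F0 _).
have E (x k : R) : move_along e a (k * x)%R = move_along e (fun c => k * a c)%R x.
  by apply/funext => c; rewrite /move_along mulrCA mulrA.
under [in X in _ = X -> _]eq_integral do rewrite E.
move=> <-; apply: eq_integral => x _; apply: eq_integral => y _; congr F.
apply/funext => c; rewrite /move_along; ring.
Qed.

Lemma average_expR_shift a (b : R) F e : nonneg_functional F ->
  \int[gam]_x ((expR (x * b))%:E * F (move_along e a x)) =
  (expR (b ^+ 2 / 2))%:E * average a F (move_along e a b).
Proof.
move=> [mF F0].
have := @ge0_integral_std_normal_shift R b (fun x => F (move_along e a x)) (measurable_line a e mF) (fun=> F0 _).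
under eq_integral do rewrite mulrC.
move=> ->; congr (_ * _); apply: eq_integral => x _; congr F.
by apply/funext => c; rewrite /move_along; ring.
Qed.

End average.

(** Moves commute with linear maps. This transports averages from fields on configurations to the
    coefficients of a linear field. *)
Lemma averages_comp (C C' : Type) (f : (C' -> R) -> (C -> R)) (D : seq (C' -> R)) F e :
  (forall e a x, f (move_along e a x) = move_along (f e) (f a) x) ->
  averages (map f D) F (f e) = averages D (F \o f) e.
Proof.
move=> lf; elim: D e => //= a D IH e.
by rewrite /average; apply: eq_integral => x _; rewrite -lf IH.
Qed.

End gaussian_average.

(** * From independent couplings to product measures *)

Section independence.
Context {R : realType} d (T : measurableType d) (P : probability T R) (I : choiceType).
Variables (A : set I) (X : I -> {RV P >-> R}).
Hypothesis iidX : iid_standard_normal A X.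
Local Notation gam := (@std_normal R).
Local Open Scope ereal_scope.

Definition cylinders (l : seq I) : set (set T) :=
  [set S | exists2 B : I -> set R, (forall j, measurable (B j)) &
     S = \bigcap_(j in [set` l]) (X j @^-1` B j)].

Let cylinders_measurable l : cylinders l `<=` measurable.
Proof.
move=> _ [B mB ->]; apply: fin_bigcap_measurable; first exact: finite_seq.
by move=> j _; rewrite -[X in measurable X]setTI; exact: measurable_funPT.
Qed.

Let cylinders_setI l : setI_closed (cylinders l).
Proof.
move=> _ _ [B mB ->] [B' mB' ->]; exists (fun j => B j `&` B' j).
  by move=> j; exact: measurableI.
by rewrite -bigcapI.
Qed.

Let cylinders_setT l : cylinders l setT.
Proof. by exists (fun=> setT) => //; apply/seteqP; split. Qed.

Let cylinders_preimage l j (B : set R) : j \in l -> measurable B ->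
  cylinders l (X j @^-1` B).
Proof.
move=> jl mB; exists (fun k => if k == j then B else setT).
  by move=> k; case: ifP.
apply/seteqP; split => [w Bw k /= kl|w /(_ j jl)/=]; last by rewrite eqxx.
by case: eqP => [->|].
Qed.

Lemma measurable_cylinders l j : j \in l ->
  measurable_fun [set: g_sigma_algebraType (cylinders l)] (X j).
Proof.
move=> jl _ B mB; rewrite setTI; apply: sub_sigma_algebra.
exact: cylinders_preimage.
Qed.

(** Both sides are finite measures in [S] that agree on the cylinders, a family stable under
    intersection, hence on the sigma-algebra it generates. *)
Lemma independent_coordinate i l (B : set R) (S : set T) :
  uniq (i :: l) -> (forall j, j \in i :: l -> A j) -> measurable B ->
  <<s cylinders l >> S -> P (X i @^-1` B `&` S) = gam B * P S.
Proof.
move=> /= /andP[il ul] Al mB sS.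
have mXB : measurable (X i @^-1` B) by rewrite -[X in measurable X]setTI; exact: measurable_funPT.
have gB : gam B = (fine (gam B))%:E by rewrite fineK// fin_num_measure.
have gB0 : (0 <= fine (gam B))%R by rewrite fine_ge0.
have XiB : P (X i @^-1` B) = gam B.
  by rewrite std_normalE -(iidX.1 i _ B mB)//; apply: Al; rewrite mem_head.
pose m1 := mrestr P mXB.
pose m2 := mscale (NngNum gB0) P.
rewrite setIC -[LHS]/(m1 S) gB -[RHS]/(m2 S).
apply: (g_sigma_algebra_measure_unique (cylinders l) _ (fun=> setT)) => //.
- by rewrite bigcup_const//; exists 0%N.
- move=> _ [D mD ->]; rewrite -[LHS]/(P (_ `&` _)) -[RHS]/((fine (gam B))%:E * P _) -gB.
  have -> : \bigcap_(j in [set` l]) (X j @^-1` D j) `&` X i @^-1` B =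
      \bigcap_(j in [set` i :: l]) (X j @^-1` (if j == i then B else D j)).
    apply/seteqP; split => [w [Dw Bw] j /=|w Dw].
      by rewrite inE => /predU1P[->|jl]; [rewrite eqxx|case: eqP => [->//|_]; exact: Dw].
    split; last by have := Dw i; rewrite /= eqxx; apply; rewrite mem_head.
    move=> j /= jl; have := Dw j; rewrite /= inE jl orbT => /(_ isT).
    by case: eqP => // ji; move: il; rewrite -ji jl.
  rewrite iidX.2/=; last 2 first.
  - by rewrite /= il.
  - by move=> j jl; split; [exact: Al|case: ifP].
  rewrite iidX.2//; last by move=> j jl; split=> //; apply: Al; rewrite inE jl orbT.
  rewrite big_cons eqxx XiB; congr (_ * _); apply: eq_big_seq => j jl.
  by case: eqP => // ji; move: il; rewrite -ji jl.
- move=> _; rewrite -[X in X < _]/(P (setT `&` _)) setTI.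
  by rewrite (le_lt_trans (probability_le1 _ _))// ltry.
Qed.

(** The identity is seen as a random element of the coarser space generated by the couplings in [l].
    The joint law of [X i] and of this element is a product measure, so Tonelli applies to every [H]
    measurable for that coarser space. *)
Lemma ge0_integral_independent_coordinate i l (H : R * g_sigma_algebraType (cylinders l) -> \bar R) :
  uniq (i :: l) -> (forall j, j \in i :: l -> A j) ->
  measurable_fun setT H -> (forall z, 0 <= H z) ->
  \int[P]_w H (X i w, w) = \int[P]_w \int[gam]_x H (x, w).
Proof.
move=> ul Al mH H0.
pose T' := g_sigma_algebraType (cylinders l).
have midT : measurable_fun [set: T] (id : T -> T').
  move=> _ S sS; rewrite setTI preimage_id.
  exact: (smallest_sub (@sigma_algebra_measurable _ T) (@cylinders_measurable l)).
pose XT w : measurableTypeR R * T' := (X i w, w).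
have mXid : measurable_fun [set: T] XT.
  by apply: measurable_fun_pair => //; exact: (measurable_funPT (X i)).
pose P' : probability T' R := distribution P (mfun_of midT).
pose m : probability (measurableTypeR R * T')%type R := distribution P (mfun_of mXid).
have -> : \int[P]_w H (X i w, w) = \int[m]_z H z.
  by rewrite ge0_integral_distribution.
have mE (S : set (measurableTypeR R * T')) : measurable S -> (gam \x P')%E S = m S.
  apply: product_measure_unique => B S' mB mS'.
  exact: (independent_coordinate ul Al mB mS').
have -> : \int[m]_z H z = \int[(gam \x P')%E]_z H z.
  by apply: eq_measure_integral => S mS _; first [exact: mE|exact/esym/mE].
rewrite fubini_tonelli1// (fubini_tonelli (m1 := gam) (m2 := P'))//.
apply: ge0_integral_distribution; last by move=> y; exact: integral_ge0.
exact: (@measurable_fun_fubini_tonelli_G _ _ (measurableTypeR R) T' R gam H mH H0).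
Qed.

End independence.

(** * Expectations over the disorder as iterated averages *)

Section expectation.
Context {R : realType} d (T : measurableType d) (P : probability T R) (I : choiceType).
Variables (A : set I) (X : I -> {RV P >-> R}).
Hypothesis iidX : iid_standard_normal A X.
Local Open Scope ereal_scope.
Context {C : Type}.

(** The couplings are integrated out one by one: given those in the tail, the head coupling turns
    [F] into [average (a i) F], to which the induction hypothesis applies. *)
Lemma ge0_expectation_averages (l : seq I) (a : I -> C -> R) F e :
  uniq l -> (forall j, j \in l -> A j) -> nonneg_functional F ->
  \int[P]_w F (fun c => e c + \sum_(i <- l) X i w * a i c)%R = averages (map a l) F e.
Proof.
elim: l F => [|i l IH] F ul Al nF.
  under eq_integral do under eq_fun do rewrite big_nil addr0.
  transitivity (F e * P setT); first exact: integral_cst.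
  by rewrite [X in _ * X](probability_setT P) mule1.
rewrite /= -averages_average// -IH; last 3 first.
- by move: ul => /andP[].
- by move=> j jl; apply: Al; rewrite inE jl orbT.
- exact: average_nonneg.
pose Y (w : g_sigma_algebraType (cylinders X l)) c := (e c + \sum_(j <- l) X j w * a j c)%R.
pose H (z : R * g_sigma_algebraType (cylinders X l)) := F (move_along (Y z.2) (a i) z.1).
transitivity (\int[P]_w H (X i w, w)).
  apply: eq_integral => w _; rewrite /H; congr F; apply/funext => c.
  by rewrite /move_along /Y big_cons/= -addrA [X in (_ + X)%R]addrC.
apply: (ge0_integral_independent_coordinate iidX) => //; last by move=> z; exact: nF.2.
apply: nF.1; apply: measurable_move_along => // c.
apply: measurable_funD => //.
pose h j (z : R * g_sigma_algebraType (cylinders X l)) := (if j \in l then X j z.2 * a j c else 0)%R.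
rewrite (_ : (fun z => _) = (fun z => \sum_(j <- l) h j z)%R); last first.
  by apply/funext => z; apply: eq_big_seq => j jl; rewrite /h jl.
apply: measurable_sum => j; rewrite /h; have [jl|jl] := boolP (j \in l); last exact: measurable_cst.
apply: measurable_funM => //.
have mX : measurable_fun [set: g_sigma_algebraType (cylinders X l)] (X j).
  exact: measurable_cylinders.
exact: (measurableT_comp mX measurable_snd).
Qed.

End expectation.

Section nonneg_measurable.
Context {R : realType} d (T : measurableType d).
Implicit Types (f g : T -> \bar R) (mu : {measure set T -> \bar R}).
Local Open Scope ereal_scope.

Definition nonneg_measurable f := measurable_fun [set: T] f /\ forall x, 0 <= f x.

Lemma nonneg_measurable_cst (k : \bar R) : 0 <= k -> nonneg_measurable (fun=> k).
Proof. by move=> k0; split=> //; exact: measurable_cst. Qed.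

Lemma nonneg_measurableD f g : nonneg_measurable f -> nonneg_measurable g ->
  nonneg_measurable (fun x => f x + g x).
Proof.
move=> [mf f0] [mg g0]; split; first exact: emeasurable_funD.
by move=> x; rewrite adde_ge0.
Qed.

Lemma nonneg_measurableM f g : nonneg_measurable f -> nonneg_measurable g ->
  nonneg_measurable (fun x => f x * g x).
Proof.
move=> [mf f0] [mg g0]; split; first exact: emeasurable_funM.
by move=> x; rewrite mule_ge0.
Qed.

Lemma nonneg_measurableZ (k : \bar R) f : 0 <= k -> nonneg_measurable f ->
  nonneg_measurable (fun x => k * f x).
Proof. by move=> k0; apply: nonneg_measurableM; exact: nonneg_measurable_cst. Qed.

Lemma nonneg_measurable_expR (h : T -> R) : measurable_fun [set: T] h ->
  nonneg_measurable (fun x => (expR (h x))%:E).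
Proof.
move=> mh; split; last by move=> x; rewrite lee_fin expR_ge0.
by apply/measurable_EFinP; exact: measurableT_comp.
Qed.

Lemma nonneg_measurable_EFin (h : T -> R) : measurable_fun [set: T] h ->
  (forall x, 0 <= h x)%R -> nonneg_measurable (fun x => (h x)%:E).
Proof. by move=> mh h0; split; first exact/measurable_EFinP. Qed.

Lemma integral_nonneg_measurableD mu f g : nonneg_measurable f -> nonneg_measurable g ->
  \int[mu]_x (f x + g x) = \int[mu]_x f x + \int[mu]_x g x.
Proof. by move=> [mf f0] [mg g0]; rewrite ge0_integralD. Qed.

Lemma integral_nonneg_measurableZl mu (k : \bar R) f : 0 <= k -> nonneg_measurable f ->
  \int[mu]_x (k * f x) = k * \int[mu]_x f x.
Proof. by move=> k0 [mf f0]; rewrite ge0_integralZl. Qed.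

Lemma integral_nonneg_measurableZr mu (k : \bar R) f : 0 <= k -> nonneg_measurable f ->
  \int[mu]_x (f x * k) = (\int[mu]_x f x) * k.
Proof. by move=> k0 [mf f0]; rewrite ge0_integralZr. Qed.

Lemma le_integral_nonneg_measurable mu f g : nonneg_measurable f -> nonneg_measurable g ->
  (forall x, f x <= g x) -> \int[mu]_x f x <= \int[mu]_x g x.
Proof. by move=> [mf f0] [mg g0] fg; apply: ge0_le_integral. Qed.

Lemma integral_nonneg_measurable_ge0 mu f : nonneg_measurable f -> 0 <= \int[mu]_x f x.
Proof. by move=> [_ f0]; apply: integral_ge0. Qed.

End nonneg_measurable.

(** * Laplace transform of a Lipschitz function of one Gaussian *)

Section concentration.
Context {R : realType}.
Local Notation gam := (@std_normal R).
Local Open Scope ereal_scope.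

(** With [p = exp |u|] and [q = exp |v|], the inequality is [1/p - 1/q = (q - p) / (p q) <= q - p],
    which holds because [p q >= 1]. *)
Lemma cosh_le (u v : R) : (`|u| <= `|v| ->
  expR (- u) + expR u <= expR (- v) + expR v)%R.
Proof.
move=> uv.
have norm (w : R) : (expR (- w) + expR w = expR (- `|w|) + expR `|w|)%R.
  by case: (ger0P w) => // _; rewrite opprK addrC.
rewrite (norm u) (norm v).
have := expR_gt0 `|u|; have := expR_gt0 `|v|.
have : (expR `|u| <= expR `|v|)%R by rewrite ler_expR.
have : (1 <= expR `|u|)%R by rewrite -expR0 ler_expR.
rewrite !expRN; set p := expR _; set q := expR _ => p1 pq q0 p0.
have -> : (p^-1 = q^-1 + (q - p) * (p^-1 * q^-1))%R.
  by field; rewrite !gt_eqF.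
have pi1 : (p^-1 <= 1)%R by rewrite invf_le1.
have qi1 : (q^-1 <= 1)%R by rewrite invf_le1//; exact: le_trans pq.
have : (p^-1 * q^-1 <= 1)%R by rewrite mulr_ile1// ?invr_ge0 ?ltW.
by set w := (_ * _)%R => w1; nra.
Qed.

(* The proof symmetrizes [f x - f y] over two independent copies. *)
Lemma std_normal_lipschitz_laplace (f : R -> R) (c lam : R) :
  (0 <= lam)%R -> measurable_fun [set: R] f -> (forall x, 0 <= f x)%R ->
  (forall x y, f x - f y <= c * `|x - y|)%R ->
  \int[gam]_x (f x)%:E < +oo ->
  \int[gam]_x (expR (- lam * f x))%:E <=
    (expR (- lam * fine (\int[gam]_x (f x)%:E) + lam ^+ 2 * c ^+ 2))%:E.
Proof.
move=> lam0 mf f0 fL fi.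
have nE (k : R) : nonneg_measurable (fun x : measurableTypeR R => (expR (k * f x))%:E).
  by apply: nonneg_measurable_expR; exact: measurable_funM.
have nX (k : R) : nonneg_measurable (fun x : measurableTypeR R => (expR (k * x))%:E).
  by apply: nonneg_measurable_expR; exact: measurable_funM.
have nf : nonneg_measurable (fun x : measurableTypeR R => (f x)%:E).
  exact: nonneg_measurable_EFin.
have E0 (x : R) : 0 <= (expR x)%:E by rewrite lee_fin expR_ge0.
have I0 := integral_nonneg_measurable_ge0 gam nf.
set m := fine _.
have mE : \int[gam]_x (f x)%:E = m%:E by rewrite fineK// ge0_fin_numE.
have m0 : (0 <= m)%R by rewrite fine_ge0.
set A := \int[gam]_x _.
have A0 : 0 <= A := integral_nonneg_measurable_ge0 gam (nE _).
pose B := \int[gam]_x (expR (lam * f x))%:E.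
have B0 : 0 <= B := integral_nonneg_measurable_ge0 gam (nE _).
(* Jensen from the tangent of [exp] at [lam * m]; the negative constant is moved to the right so
   that both integrands are nonnegative. *)
have jensen : (expR (lam * m))%:E <= B.
  have H x : (expR (lam * m))%:E + (expR (lam * m) * lam)%:E * (f x)%:E <=
             (expR (lam * f x))%:E + (expR (lam * m) * lam * m)%:E.
    rewrite -EFinM -!EFinD lee_fin.
    have -> : (expR (lam * f x) = expR (lam * m) * expR (lam * f x - lam * m))%R.
      by rewrite -expRD addrC subrK.
    have := expR_ge1Dx (lam * f x - lam * m)%R.
    have := expR_gt0 (lam * m)%R; nra.
  have k0 : 0 <= (expR (lam * m) * lam)%:E by rewrite lee_fin mulr_ge0// expR_ge0.
  have k1 : 0 <= (expR (lam * m) * lam * m)%:E by rewrite lee_fin !mulr_ge0// expR_ge0.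
  have nZ := nonneg_measurableZ k0 nf.
  have nC := @nonneg_measurable_cst R _ (measurableTypeR R) _ (E0 (lam * m)%R).
  have nC' := @nonneg_measurable_cst R _ (measurableTypeR R) _ k1.
  have := le_integral_nonneg_measurable gam (nonneg_measurableD nC nZ) (nonneg_measurableD (nE lam) nC') H.
  rewrite (integral_nonneg_measurableD gam nC nZ).
  rewrite (integral_nonneg_measurableD gam (nE lam) nC').
  rewrite (integral_nonneg_measurableZl gam k0 nf) !integral_std_normal_cst mE -EFinM.
  by rewrite leeD2rE.
(* For independent copies, [2 A B] is the mean of [2 cosh (lam (f x - f y))]. This is at most the
   mean of [2 cosh (lam c (x - y))], which is explicit because [x - y] has variance 2. *)
have AB : A * B <= (expR (lam ^+ 2 * c ^+ 2))%:E.
  pose g (z : R * R) := (expR (- lam * f z.1))%:E * (expR (lam * f z.2))%:E +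
       (expR (lam * f z.1))%:E * (expR (- lam * f z.2))%:E.
  pose h (z : R * R) := (expR (- (lam * c) * z.1))%:E * (expR ((lam * c) * z.2))%:E +
       (expR ((lam * c) * z.1))%:E * (expR (- (lam * c) * z.2))%:E.
  have nM (k l x : R) := @nonneg_measurableZ R _ (measurableTypeR R) _ _ (E0 (k * f x)%R) (nE l).
  have nM' (k l x : R) := @nonneg_measurableZ R _ (measurableTypeR R) _ _ (E0 (k * x)%R) (nX l).
  have gE : \int[gam]_x \int[gam]_y g (x, y) = A * B + A * B.
    transitivity (\int[gam]_x ((expR (- lam * f x))%:E * B + (expR (lam * f x))%:E * A)).
      apply: eq_integral => x _; rewrite /g/= (integral_nonneg_measurableD gam (nM _ _ x) (nM _ _ x)).
      by rewrite !(integral_nonneg_measurableZl gam (E0 _) (nE _)).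
    have nB := @nonneg_measurable_cst R _ (measurableTypeR R) _ B0.
    have nA := @nonneg_measurable_cst R _ (measurableTypeR R) _ A0.
    rewrite integral_nonneg_measurableD; last 2 first.
    - exact: nonneg_measurableM (nE _) nB.
    - exact: nonneg_measurableM (nE _) nA.
    rewrite (integral_nonneg_measurableZr gam B0 (nE _)) (integral_nonneg_measurableZr gam A0 (nE _)).
    by rewrite -/A -/B [B * A]muleC.
  have hE : \int[gam]_x \int[gam]_y h (x, y) =
      (expR (lam ^+ 2 * c ^+ 2))%:E + (expR (lam ^+ 2 * c ^+ 2))%:E.
    pose K := (expR ((lam * c) ^+ 2 / 2)).
    transitivity (\int[gam]_x ((expR (- (lam * c) * x))%:E * K%:E + (expR ((lam * c) * x))%:E * K%:E)).
      apply: eq_integral => x _; rewrite /h/= (integral_nonneg_measurableD gam (nM' _ _ x) (nM' _ _ x)).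
      rewrite !(integral_nonneg_measurableZl gam (E0 _) (nX _)).
      by rewrite !integral_std_normal_expR sqrrN.
    have nK := @nonneg_measurable_cst R _ (measurableTypeR R) _ (E0 ((lam * c) ^+ 2 / 2)%R).
    rewrite integral_nonneg_measurableD; last 2 first.
    - exact: nonneg_measurableM (nX _) nK.
    - exact: nonneg_measurableM (nX _) nK.
    rewrite !(integral_nonneg_measurableZr gam (E0 _) (nX _)).
    rewrite !integral_std_normal_expR sqrrN /K -!EFinM -!expRD.
    by rewrite (_ : (_ / 2 + _ / 2)%R = (lam ^+ 2 * c ^+ 2)%R)//; field.
  have mG (k l : R) : measurable_fun [set: R * R] (fun z : R * R => (expR (k * f z.1))%:E * (expR (l * f z.2))%:E).
    apply: emeasurable_funM.
      exact: (measurableT_comp (nE k).1).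
    exact: (measurableT_comp (nE l).1).
  have mG' (k l : R) : measurable_fun [set: R * R] (fun z : R * R => (expR (k * z.1))%:E * (expR (l * z.2))%:E).
    apply: emeasurable_funM.
      exact: (measurableT_comp (nX k).1).
    exact: (measurableT_comp (nX l).1).
  have mg : measurable_fun setT g by exact: emeasurable_funD.
  have mh : measurable_fun setT h by exact: emeasurable_funD.
  have g0 z : 0 <= g z by rewrite adde_ge0// mule_ge0.
  have h0 z : 0 <= h z by rewrite adde_ge0// mule_ge0.
  have gh z : g z <= h z.
    rewrite /g /h -!EFinM -!EFinD lee_fin -!expRD.
    have -> : (- lam * f z.1 + lam * f z.2 = - (lam * (f z.1 - f z.2)))%R by ring.
    have -> : (lam * f z.1 + - lam * f z.2 = (lam * (f z.1 - f z.2)))%R by ring.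
    have -> : (- (lam * c) * z.1 + lam * c * z.2 = - (lam * c * (z.1 - z.2)))%R by ring.
    have -> : (lam * c * z.1 + - (lam * c) * z.2 = (lam * c * (z.1 - z.2)))%R by ring.
    apply: cosh_le; rewrite -mulrA !normrM ler_wpM2l//.
    have c0 : (c * `|z.1 - z.2| <= `|c| * `|z.1 - z.2|)%R by rewrite ler_wpM2r// ler_norm.
    rewrite ler_norml; apply/andP; split; last exact: le_trans (fL _ _) c0.
    by rewrite lerNl opprB; apply: le_trans (fL _ _) _; rewrite distrC.
  have : \int[gam]_x \int[gam]_y g (x, y) <= \int[gam]_x \int[gam]_y h (x, y).
    apply: ge0_le_integral => //.
    - by move=> x _; apply: integral_ge0 => y _; exact: g0.
    - exact: (@measurable_fun_fubini_tonelli_F _ _ (measurableTypeR R) (measurableTypeR R) R gam g mg g0).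
    - exact: (@measurable_fun_fubini_tonelli_F _ _ (measurableTypeR R) (measurableTypeR R) R gam h mh h0).
    move=> x _; apply: ge0_le_integral => //.
    - exact: (measurableT_comp mg (measurable_pair1 x)).
    - exact: (measurableT_comp mh (measurable_pair1 x)).
  rewrite gE hE; apply: contraTT; rewrite -!ltNge => lt_AB.
  exact: lteD.
have : A * (expR (lam * m))%:E <= (expR (lam ^+ 2 * c ^+ 2))%:E.
  by apply: le_trans AB; rewrite lee_pmul.
rewrite -lee_pdivlMr ?expR_gt0// => /le_trans; apply.
by rewrite -expRN -EFinM -expRD lee_fin ler_expR mulNr addrC.
Qed.

End concentration.

(** * Concentration and change of amplitude for many Gaussians *)

Section functional_concentration.
Context {R : realType} {C : Type}.
Local Notation gam := (@std_normal R).
Local Open Scope ereal_scope.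
Implicit Types (F G : (C -> R) -> \bar R) (a b e : C -> R).

(** The 1-Lipschitz property for the uniform norm on fields: along a direction bounded by [k], the
    functional is [k]-Lipschitz in the Gaussian variable. *)
Definition lipschitz_functional F : Prop :=
  (forall e, F e < +oo) /\
  forall e e' r, (0 <= r)%R -> (forall c, `|e' c - e c| <= r)%R -> F e' <= F e + r%:E.

Lemma nonneg_measurable_line a e F : nonneg_functional F ->
  @nonneg_measurable R _ (measurableTypeR R) (fun x => F (move_along e a x)).
Proof. by move=> [mF F0]; split; [exact: measurable_line|move=> x; exact: F0]. Qed.

Lemma average_lipschitz a (k : R) F : nonneg_functional F ->
  (forall c, `|a c| <= k)%R -> lipschitz_functional F ->
  lipschitz_functional (average a F).
Proof.
move=> nF ak [Foo FL].
have nC (r : R) : (0 <= r)%R -> @nonneg_measurable R _ (measurableTypeR R) (fun=> r%:E).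
  by move=> r0; apply: nonneg_measurable_cst; rewrite lee_fin.
have nX (j : R) : @nonneg_measurable R _ (measurableTypeR R) (fun x => (expR (j * x))%:E).
  by apply: nonneg_measurable_expR; exact: measurable_funM.
split=> [e|e e' r r0 ee'].
  (* [k] can be negative when [C] is empty. The average is finite because [|x| <= exp x + exp (- x)]
     gives an integrable majorant. *)
  pose k' := Num.max k 0%R.
  have k'0 : (0 <= k')%R by rewrite le_max lexx orbT.
  have k'0' : 0 <= k'%:E by rewrite lee_fin.
  have nXX := nonneg_measurableD (nX 1%R) (nX (-1)%R).
  have F0 := nF.2 e.
  apply: (@le_lt_trans _ _ (\int[gam]_x (F e + k'%:E * ((expR (1 * x))%:E + (expR (-1 * x))%:E)))).
    apply: le_integral_nonneg_measurable; first exact: nonneg_measurable_line.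
      apply: nonneg_measurableD; first exact: nonneg_measurable_cst.
      exact: nonneg_measurableZ.
    move=> x; apply: (@le_trans _ _ (F e + (k' * `|x|)%:E)).
      apply: FL; first by rewrite mulr_ge0.
      move=> c; rewrite /move_along addrC addKr normrM mulrC ler_wpM2r//.
      by rewrite (le_trans (ak c))// le_max lexx.
    rewrite leeD2l// -EFinD -EFinM lee_fin ler_wpM2l// mul1r mulN1r.
    have := expR_ge1Dx `|x|%R; case: (ger0P x) => x0 H.
      by have := expR_gt0 (- x)%R; lra.
    by have := expR_gt0 x; lra.
  rewrite (integral_nonneg_measurableD gam (@nonneg_measurable_cst R _ (measurableTypeR R) _ F0) (nonneg_measurableZ k'0' nXX)).
  rewrite (integral_nonneg_measurableZl gam k'0' nXX).
  rewrite (integral_nonneg_measurableD gam (nX _) (nX _)) !integral_std_normal_expR integral_std_normal_cst.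
  by rewrite lte_add_pinfty// -EFinD -EFinM ltry.
have -> : average a F e + r%:E = \int[gam]_x (F (move_along e a x) + r%:E).
  rewrite (integral_nonneg_measurableD gam (nonneg_measurable_line a e nF) (nC r r0)).
  by rewrite integral_std_normal_cst.
apply: le_integral_nonneg_measurable.
- exact: nonneg_measurable_line.
- exact: nonneg_measurableD (nonneg_measurable_line a e nF) (nC r r0).
- by move=> x; apply: FL => // c; rewrite /move_along opprD addrACA subrr addr0.
Qed.

Lemma averages_lipschitz (I : eqType) (l : seq I) (a : I -> C -> R) (k : I -> R) F :
  nonneg_functional F -> (forall i c, i \in l -> `|a i c| <= k i)%R ->
  lipschitz_functional F -> lipschitz_functional (averages (map a l) F).
Proof.
move=> nF + LF; elim: l => //= i l IH ak.
apply: (@average_lipschitz _ (k i)).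
- exact: averages_nonneg.
- by move=> c; apply: ak; rewrite mem_head.
- by apply: IH => j c jl; apply: ak; rewrite inE jl orbT.
Qed.

Lemma lipschitz_fineK F e : nonneg_functional F -> lipschitz_functional F ->
  (fine (F e))%:E = F e.
Proof. by move=> nF [Foo _]; rewrite fineK// ge0_fin_numE//; exact: nF.2. Qed.

Lemma nonneg_functional_expR F (k : R) : nonneg_functional F ->
  nonneg_functional (fun e => (expR (k * fine (F e)))%:E).
Proof.
move=> [mF F0]; split; last by move=> e; rewrite lee_fin expR_ge0.
move=> d T e me; apply/measurable_EFinP; apply: measurableT_comp => //.
apply: measurable_funM => //; apply: measurableT_comp => //; exact: mF.
Qed.

Lemma average_concentration a (k lam : R) F e : (0 <= lam)%R -> (0 <= k)%R ->
  nonneg_functional F -> (forall c, `|a c| <= k)%R -> lipschitz_functional F ->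
  average a (fun e' => (expR (- lam * fine (F e')))%:E) e <=
  (expR (- lam * fine (average a F e) + lam ^+ 2 * k ^+ 2))%:E.
Proof.
move=> lam0 k0 nF ak LF.
have [aFoo _] := average_lipschitz nF ak LF.
pose f x := fine (F (move_along e a x)).
have fE : \int[gam]_x (f x)%:E = average a F e.
  by apply: eq_integral => x _; rewrite /f (lipschitz_fineK _ nF LF).
have := @std_normal_lipschitz_laplace R f k lam lam0; rewrite fE; apply.
- by apply: measurableT_comp => //; exact: measurable_line nF.1.
- by move=> x; rewrite fine_ge0//; exact: nF.2.
- move=> x y; rewrite lerBlDl -lee_fin EFinD /f !(lipschitz_fineK _ nF LF).
  apply: LF.2; first by rewrite mulr_ge0.
  move=> c'; rewrite /move_along opprD addrACA subrr add0r -mulrBl normrM mulrC.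
  by rewrite ler_wpM2r.
- exact: aFoo.
Qed.

(** Martingale argument: the functional averaged over the tail is still Lipschitz, so the Gaussian
    [i] adds [lam^2 k_i^2] to the exponent. The cost is thus governed by the total variance, of
    order [N] in the application. *)
Lemma averages_concentration (I : eqType) (l : seq I) (a : I -> C -> R) (k : I -> R)
    (lam : R) F e : (0 <= lam)%R -> (forall i, 0 <= k i)%R -> nonneg_functional F ->
  (forall i c, i \in l -> `|a i c| <= k i)%R -> lipschitz_functional F ->
  averages (map a l) (fun e' => (expR (- lam * fine (F e')))%:E) e <=
  (expR (- lam * fine (averages (map a l) F e) + lam ^+ 2 * \sum_(i <- l) k i ^+ 2))%:E.
Proof.
move=> lam0 k0 nF + LF; elim: l e => [|i l IH] e ak.
  by rewrite big_nil mulr0 addr0.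
have ak' j c : j \in l -> (`|a j c| <= k j)%R by move=> jl; apply: ak; rewrite inE jl orbT.
set F' := averages (map a l) F.
have nF' : nonneg_functional F' by exact: averages_nonneg.
have LF' : lipschitz_functional F' := averages_lipschitz nF ak' LF.
pose K := expR (lam ^+ 2 * \sum_(j <- l) k j ^+ 2).
have K0 : (0 <= K)%R by exact: expR_ge0.
have nE := nonneg_functional_expR (- lam)%R nF'.
apply: (@le_trans _ _ (average (a i) (fun e' => K%:E * (expR (- lam * fine (F' e')))%:E) e)).
  apply: le_average.
  - by apply: averages_nonneg; exact: nonneg_functional_expR.
  - exact: nonneg_functionalM (nonneg_functional_cst K0) nE.
  - move=> e'; apply: le_trans (IH e' ak') _.
    by rewrite -EFinM -expRD addrC.
rewrite averageZ//.
apply: (@le_trans _ _ (K%:E * (expR (- lam * fine (average (a i) F' e) + lam ^+ 2 * k i ^+ 2))%:E)).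
  rewrite lee_wpmul2l ?lee_fin//; apply: average_concentration => // c.
  by apply: ak; rewrite mem_head.
rewrite -EFinM -expRD big_cons lee_fin ler_expR /=.
by rewrite -/F' mulrDr addrCA [X in (_ <= _ + X)%R]addrC.
Qed.

(* Functionals growing at most like [ln (sum exp)] under a Gaussian
   perturbation of constant variance. *)
Definition log_subgaussian F : Prop :=
  forall a (k : R), (forall c, a c ^+ 2 = k ^+ 2)%R ->
  forall e, average a F e <= F e + (k ^+ 2 / 2)%:E.

Lemma average_log_subgaussian b F : nonneg_functional F ->
  log_subgaussian F -> log_subgaussian (average b F).
Proof.
move=> nF sF a k ak e; rewrite averageC//.
have k0 : (0 <= k ^+ 2 / 2)%R by rewrite divr_ge0// sqr_ge0.
apply: (@le_trans _ _ (average b (fun e => F e + (k ^+ 2 / 2)%:E) e)).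
  apply: le_average.
  - exact: average_nonneg.
  - exact: nonneg_functionalD nF (nonneg_functional_cst k0).
  - by move=> e'; exact: sF.
by rewrite (averageD b e nF (nonneg_functional_cst k0)) average_cst.
Qed.

Lemma averages_log_subgaussian D F : nonneg_functional F ->
  log_subgaussian F -> log_subgaussian (averages D F).
Proof.
move=> nF sF; elim: D => //= b D IH.
by apply: average_log_subgaussian => //; exact: averages_nonneg.
Qed.

(** In law, a Gaussian of amplitude [s] is the sum of independent ones of amplitudes [r] and
    [u = sqrt (s^2 - r^2)]; log-subgaussianity bounds what the second one adds. This is the
    interpolation between two temperatures. *)
Lemma averages_log_subgaussian_scale (I : eqType) (l : seq I) (a : I -> C -> R) (k : I -> R)
    (r s : R) F e : (0 <= r <= s)%R -> nonneg_functional F -> log_subgaussian F ->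
  (forall i c, i \in l -> a i c ^+ 2 = k i ^+ 2)%R ->
  averages [seq (fun c => s * a i c)%R | i <- l] F e <=
  averages [seq (fun c => r * a i c)%R | i <- l] F e +
    ((s ^+ 2 - r ^+ 2) / 2 * \sum_(i <- l) k i ^+ 2)%:E.
Proof.
move=> /andP[r0 rs] nF sF; elim: l e => [|i l IH] e ak.
  by rewrite big_nil mulr0 addr0.
have ak' j c : j \in l -> (a j c ^+ 2 = k j ^+ 2)%R by move=> jl; apply: ak; rewrite inE jl orbT.
have s0 : (0 <= s)%R by exact: le_trans rs.
have sr0 : (0 <= s ^+ 2 - r ^+ 2)%R by rewrite subr_ge0 ler_pXn2r.
set Fs := averages [seq (fun c => s * a i c)%R | i <- l] F.
set Fr := averages [seq (fun c => r * a i c)%R | i <- l] F.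
have nFs : nonneg_functional Fs by exact: averages_nonneg.
have nFr : nonneg_functional Fr by exact: averages_nonneg.
pose u := Num.sqrt (s ^+ 2 - r ^+ 2).
have u2 : (u ^+ 2 = s ^+ 2 - r ^+ 2)%R by rewrite sqr_sqrtr.
have sE : s = Num.sqrt (r ^+ 2 + u ^+ 2).
  by rewrite u2 addrC subrK sqrtr_sqr ger0_norm.
rewrite /= -/Fs -/Fr {1}sE -average_merge//.
set K1 := (u ^+ 2 * k i ^+ 2 / 2)%R; set K2 := ((s ^+ 2 - r ^+ 2) / 2 * \sum_(j <- l) k j ^+ 2)%R.
have K10 : (0 <= K1)%R by rewrite divr_ge0// mulr_ge0// sqr_ge0.
have K20 : (0 <= K2)%R by rewrite mulr_ge0// ?divr_ge0// sumr_ge0// => j _; exact: sqr_ge0.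
have K12 : (0 <= K1 + K2)%R by rewrite addr_ge0.
apply: (@le_trans _ _ (average (fun c => r * a i c)%R (fun e => Fr e + (K1 + K2)%:E) e)).
  apply: le_average.
  - exact: average_nonneg.
  - exact: nonneg_functionalD nFr (nonneg_functional_cst K12).
  - move=> e'; apply: (@le_trans _ _ (Fs e' + K1%:E)).
      have := averages_log_subgaussian [seq (fun c => s * a i c)%R | i <- l] nF sF.
      move=> /(_ (fun c => u * a i c)%R (u * k i)%R); rewrite /K1 -exprMn; apply.
      by move=> c; rewrite !exprMn ak// mem_head.
    by rewrite EFinD addeCA addeC leeD2r//; exact: IH.
rewrite (averageD _ e nFr (nonneg_functional_cst K12)) average_cst leeD2l//.
rewrite lee_fin big_cons mulrDr /K1 /K2 u2 lerD2r.
by rewrite mulrAC.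
Qed.

End functional_concentration.

(** * The logarithm of the partition function as a functional *)

Section log_partition.
Context {R : realType} {C : finType}.
Local Notation gam := (@std_normal R).
Local Open Scope ereal_scope.
Implicit Types (a e : C -> R).

Definition sum_exp e : R := (\sum_(c : C) expR (e c))%R.

(* [ln (1 + Z)] rather than [ln Z], so as to stay nonnegative. *)
Definition log_sum_exp e : R := ln (1 + sum_exp e)%R.

Lemma sum_exp_ge0 e : (0 <= sum_exp e)%R.
Proof. by apply: sumr_ge0 => c _; exact: expR_ge0. Qed.

Lemma measurable_sum_exp d (T : measurableType d) (f : T -> C -> R) :
  (forall c, measurable_fun [set: T] (fun x => f x c)) ->
  measurable_fun [set: T] (fun x => sum_exp (f x)).
Proof. by move=> mf; apply: measurable_sum => c; exact: measurableT_comp. Qed.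

Lemma log_sum_exp_ge0 e : (0 <= log_sum_exp e)%R.
Proof. by rewrite ln_ge0// lerDl sum_exp_ge0. Qed.

Lemma log_sum_exp_nonneg : nonneg_functional (EFin \o log_sum_exp).
Proof.
split=> [d T f mf|e]; last by rewrite lee_fin log_sum_exp_ge0.
apply/measurable_EFinP; apply: measurableT_comp; first exact: measurable_ln.
by apply: measurable_funD => //; exact: measurable_sum_exp.
Qed.

Lemma log_sum_exp_lipschitz : lipschitz_functional (EFin \o log_sum_exp).
Proof.
split=> [e|e e' r r0 ee']; first exact: ltry.
have Z0 e1 : (0 < 1 + sum_exp e1)%R by rewrite ltr_pwDl// sum_exp_ge0.
rewrite /= -EFinD lee_fin /log_sum_exp -[X in (_ <= _ + X)%R]expRK -lnM ?posrE ?expR_gt0//.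
rewrite ler_ln ?posrE ?mulr_gt0 ?expR_gt0// mulrDl mul1r lerD//.
  by rewrite -expR0 ler_expR.
rewrite /sum_exp big_distrl; apply: ler_sum => c _.
rewrite /= -expRD ler_expR addrC -lerBlDr.
by apply: le_trans (ee' c); exact: ler_norm.
Qed.

Lemma average_expR a e (c : C) :
  average a (fun e' => (expR (e' c))%:E) e = (expR (e c + a c ^+ 2 / 2))%:E.
Proof.
rewrite /average.
transitivity (\int[gam]_x ((expR (e c))%:E * (expR (a c * x))%:E)).
  by apply: eq_integral => x _; rewrite -EFinM -expRD /move_along [(x * _)%R]mulrC.
rewrite integral_nonneg_measurableZl ?lee_fin ?expR_ge0//; last first.
  by apply: nonneg_measurable_expR; exact: measurable_funM.
by rewrite integral_std_normal_expR -EFinM -expRD.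
Qed.

Lemma average_sum_exp a (k : R) e : (forall c, a c ^+ 2 = k ^+ 2)%R ->
  average a (EFin \o sum_exp) e = (expR (k ^+ 2 / 2) * sum_exp e)%:E.
Proof.
move=> ak; rewrite /average /=.
under eq_integral do rewrite /sum_exp -sumEFin.
rewrite ge0_integral_sum//; last first.
- move=> c; apply/measurable_EFinP; apply: measurableT_comp => //.
  by apply: measurable_funD => //; exact: measurable_funM.
rewrite big_distrr -sumEFin; apply: eq_bigr => c _.
by rewrite [LHS](average_expR a e c) ak expRD mulrC.
Qed.

(** Jensen for the concave logarithm: averaging multiplies [sum_exp] by [exp (k^2 / 2)] since all
    entries of [a] have the same square. *)
Lemma log_sum_exp_log_subgaussian : log_subgaussian (EFin \o log_sum_exp).
Proof.
move=> a k ak e; set K := (k ^+ 2 / 2)%R.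
have K0 : (0 <= K)%R by rewrite divr_ge0// sqr_ge0.
have K1 : (1 <= expR K)%R by rewrite -expR0 ler_expR.
have S0 := sum_exp_ge0 e.
(* [M] is the average of [1 + sum_exp], hence the right point for the tangent to [ln]; in [H] the
   constant 1 of the tangent is put on the left to keep all terms nonnegative. At the end
   [M <= expR K * (1 + sum_exp e)]. *)
pose M := (1 + expR K * sum_exp e)%R.
have M1 : (1 <= M)%R by rewrite lerDl mulr_ge0// expR_ge0.
have M0 : (0 < M)%R by exact: lt_le_trans M1.
have lnM0 : (0 <= ln M)%R by exact: ln_ge0.
have iM0 : (0 <= M^-1)%R by rewrite invr_ge0 ltW.
have nS : nonneg_functional (EFin \o sum_exp : (C -> R) -> \bar R).
  split=> [d T f mf|e']; last by rewrite lee_fin sum_exp_ge0.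
  by apply/measurable_EFinP; exact: measurable_sum_exp.
have n1 := @nonneg_functional_cst R C 1 ler01.
have nL : nonneg_functional (fun e : C -> R => (ln M + M^-1)%:E).
  by apply: nonneg_functional_cst; rewrite addr_ge0.
have nI : nonneg_functional (fun e : C -> R => (M^-1)%:E * (EFin \o sum_exp) e).
  exact: nonneg_functionalM (nonneg_functional_cst iM0) nS.
have H e' : (EFin \o log_sum_exp) e' + 1%:E <= (ln M + M^-1)%:E + (M^-1)%:E * (EFin \o sum_exp) e'.
  rewrite /= -EFinM -!EFinD lee_fin.
  have Z0 : (0 < 1 + sum_exp e')%R by rewrite ltr_pwDl// sum_exp_ge0.
  have : (ln ((1 + sum_exp e') / M) <= (1 + sum_exp e') / M - 1)%R.
    have := expR_ge1Dx (ln ((1 + sum_exp e') / M)).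
    by rewrite lnK ?posrE ?divr_gt0// -lerBrDl.
  rewrite ln_div ?posrE// /log_sum_exp; lra.
have := le_average a e (nonneg_functionalD log_sum_exp_nonneg n1) (nonneg_functionalD nL nI) H.
rewrite (averageD a e log_sum_exp_nonneg n1) (averageD a e nL nI) averageZ//.
rewrite !average_cst (average_sum_exp e ak) -/K => H2.
apply: (@le_trans _ _ (ln M)%:E).
  rewrite -(@leeD2rE _ 1%:E)//; apply: le_trans H2 _.
  rewrite -EFinM -!EFinD lee_fin -addrA lerD2l -[X in (X + _ <= _)%R]mulr1 -mulrDr.
  by rewrite mulVf// gt_eqF.
rewrite /= -EFinD lee_fin /log_sum_exp -[X in (_ <= _ + X)%R]expRK -lnM ?posrE ?expR_gt0//; last first.
  by rewrite ltr_pwDl.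
rewrite ler_ln ?posrE//; last by rewrite mulr_gt0 ?expR_gt0// ltr_pwDl.
by rewrite /M mulrDl mul1r [X in (_ <= _ + X)%R]mulrC lerD.
Qed.

End log_partition.

(** * Exponential tilting and comparison of maxima of sign fields *)

Section planted.
Context {R : realType}.
Local Notation gam := (@std_normal R).
Local Open Scope ereal_scope.

Section homogeneous.
Context {C : Type}.
Implicit Types (F G : (C -> R) -> \bar R) (a e : C -> R).

(** Lets the part of a direction that is constant over configurations leave the functional as an
    exponential weight on the Gaussian, the form needed for tilting. *)
Definition exp_homogeneous F : Prop :=
  forall e r, F (fun c => e c + r)%R = (expR r)%:E * F e.

Lemma average_exp_homogeneous a F : nonneg_functional F ->
  exp_homogeneous F -> exp_homogeneous (average a F).
Proof.
move=> nF hF e r; rewrite -averageZ ?expR_ge0//.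
apply: eq_integral => x _; rewrite -hF; congr F.
by apply/funext => c; rewrite /move_along addrAC.
Qed.

Lemma averages_exp_homogeneous D F : nonneg_functional F ->
  exp_homogeneous F -> exp_homogeneous (averages D F).
Proof.
move=> nF hF; elim: D => //= a D IH.
by apply: average_exp_homogeneous => //; exact: averages_nonneg.
Qed.

(* Girsanov: an exponential tilt shifts the mean. *)
Lemma averages_tilt (I : Type) (l : seq I) (a : I -> C -> R) (b : I -> R) F e :
  nonneg_functional F -> exp_homogeneous F ->
  averages [seq (fun c => b i + a i c)%R | i <- l] F e =
  (expR (\sum_(i <- l) b i ^+ 2 / 2))%:E *
    averages (map a l) F (fun c => e c + \sum_(i <- l) b i * a i c)%R.
Proof.
move=> nF hF; elim: l e => [|i l IH] e.
  rewrite big_nil expR0 mul1e /=; congr F; apply/funext => c.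
  by rewrite big_nil addr0.
set D := [seq (fun c => b i + a i c)%R | i <- l].
set K := expR (\sum_(i <- l) b i ^+ 2 / 2).
pose h c := (\sum_(i <- l) b i * a i c)%R.
have nD : nonneg_functional (averages D F) by exact: averages_nonneg.
have hD := averages_exp_homogeneous D nF hF.
transitivity (\int[gam]_x ((expR (x * b i))%:E * averages D F (move_along e (a i) x))).
  apply: eq_integral => x _; rewrite -/(averages D F) -hD; congr averages.
  by apply/funext => c; rewrite /move_along; ring.
rewrite average_expR_shift// big_cons expRD EFinM -muleA; congr (_ * _).
rewrite (_ : averages D F = fun e' => K%:E * averages (map a l) F (e' \+ h)%R); last first.
  by apply/funext => e'; rewrite IH.
have nS : nonneg_functional (fun e' => averages (map a l) F (e' \+ h)%R).
  have [m0 n0] := averages_nonneg (map a l) nF.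
  split=> [d T f mf|e']; last exact: n0.
  by apply: m0 => c; apply: measurable_funD.
rewrite averageZ ?expR_ge0//; congr (_ * _).
have := averages_shift [:: a i] (averages (map a l) F) h (move_along e (a i) (b i)).
rewrite /= => <-; congr average; apply/funext => c.
by rewrite big_cons /move_along/= addrA.
Qed.

End homogeneous.

Section max_exp.
Context {C : finType} (A : {set C}).
Implicit Types (a e : C -> R).

(** This is [exp (max_A e)] for nonempty [A] and 0 for empty [A], so that an empty slice contributes
    nothing. *)
Definition max_exp e : R := (\big[Num.max/0]_(c in A) expR (e c))%R.

Lemma max_exp_ge0 e : (0 <= max_exp e)%R.
Proof. exact: bigmax_ge_id. Qed.

Lemma max_exp_ge e c : c \in A -> (expR (e c) <= max_exp e)%R.
Proof. by move=> cA; apply: (le_bigmax_cond _ (fun c => expR (e c))). Qed.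

Lemma max_exp_le e (k : R) : (0 <= k)%R -> (forall c, c \in A -> expR (e c) <= k)%R ->
  (max_exp e <= k)%R.
Proof. by move=> k0 H; apply: bigmax_le. Qed.

Lemma max_exp_nonneg : nonneg_functional (EFin \o max_exp).
Proof.
split=> [d T f mf|e]; last by rewrite lee_fin max_exp_ge0.
apply/measurable_EFinP; rewrite /comp /max_exp.
have H (s : seq C) : measurable_fun [set: T] (fun x => \big[Num.max/0]_(c <- s) expR (f x c))%R.
  elim: s => [|c s IH].
    by under eq_fun do rewrite big_nil; exact: measurable_cst.
  under eq_fun do rewrite big_cons.
  by apply: measurable_maxr => //; exact: measurableT_comp.
by under eq_fun do rewrite -big_filter; exact: H.
Qed.

Lemma max_exp_homogeneous : exp_homogeneous (EFin \o max_exp).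
Proof.
have le e r : (max_exp (fun c => e c + r) <= expR r * max_exp e)%R.
  apply: max_exp_le; first by rewrite mulr_ge0 ?expR_ge0 ?max_exp_ge0.
  by move=> c cA; rewrite expRD mulrC ler_wpM2l ?expR_ge0// max_exp_ge.
move=> e r; rewrite /= -EFinM; congr EFin; apply/eqP; rewrite eq_le le /=.
rewrite -ler_pdivlMl ?expR_gt0// -expRN.
apply: le_trans (le _ (- r)%R); rewrite le_eqVlt; apply/orP; left; apply/eqP.
by congr max_exp; apply/funext => c; rewrite addrK.
Qed.

(** Each single exponential grows under averaging, by the factor [exp (a c ^ 2 / 2)], and the
    maximum dominates each of them. Hence an extra independent Gaussian can be inserted in an upper
    bound. *)
Lemma le_average_max_exp a e : (EFin \o max_exp) e <= average a (EFin \o max_exp) e.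
Proof.
have n0 := average_nonneg a max_exp_nonneg.
have H c : c \in A -> (expR (e c))%:E <= average a (EFin \o max_exp) e.
  move=> cA; apply: (@le_trans _ _ (average a (fun e' => (expR (e' c))%:E) e)).
    rewrite average_expR lee_fin ler_expR lerDl.
    by rewrite divr_ge0// sqr_ge0.
  apply: le_average; [|exact: max_exp_nonneg|].
  - split=> [d T f mf|e']; last by rewrite lee_fin expR_ge0.
    by apply/measurable_EFinP; exact: measurableT_comp.
  - by move=> e'; rewrite lee_fin max_exp_ge.
move: (n0.2 e) H; case: (average _ _ _) => [r|_ _|]//; last by rewrite leey.
rewrite lee_fin /= => r0 H; rewrite lee_fin; exact: max_exp_le.
Qed.

Definition sign_function (u : C -> R) := forall c, u c = 1%R \/ u c = (-1)%R.

Lemma sign_functionM u v : sign_function u -> sign_function v ->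
  sign_function (fun c => u c * v c)%R.
Proof.
move=> hu hv c; have [->|->] := hu c; have [->|->] := hv c;
  rewrite ?mulr1 ?mulrN1 ?opprK; by [left|right].
Qed.

(** Along [k u v] only two candidates matter: the best configuration [p] with [u v = 1] and the best
    [n] with [u v = -1]. One of [u], [v] separates them; moving along it, with the sign that gives 1
    at [p] and -1 at [n], already reaches both values. The choice depends on [e] but not on [x], so
    it survives integration. *)
Lemma max_exp_sign_product (k : R) u v e : sign_function u -> sign_function v ->
  exists w (s : R), [/\ w = u \/ w = v, s = 1%R \/ s = (-1)%R &
    forall x, (max_exp (move_along e (fun c => k * (u c * v c)) x) <=
               max_exp (move_along e (fun c => s * (k * w c)) x))%R].
Proof.
move=> hu hv.
have best (P : pred C) : (exists p, [/\ p \in A, P p &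
    forall c, c \in A -> P c -> (e c <= e p)%R]) \/ (forall c, c \in A -> ~~ P c).
  have [/existsP[c0 /andP[c0A Pc0]]|] := boolP [exists c, (c \in A) && P c].
    left; case: (@arg_maxP _ R C c0 [pred c | (c \in A) && P c] e) => [|p /andP[pA Pp] pmax].
      exact/andP.
    by exists p; split=> // c cA Pc; apply: pmax; exact/andP.
  by move/existsPn => H; right=> c cA; have := H c; rewrite cA.
suff [w [s [hw hs Hp Hn]]] : exists w (s : R), [/\ w = u \/ w = v, s = 1%R \/ s = (-1)%R,
    (forall c, c \in A -> u c * v c = 1 -> exists p, [/\ p \in A, e c <= e p & s * w p = 1])%R &
    (forall c, c \in A -> u c * v c = -1 -> exists p, [/\ p \in A, e c <= e p & s * w p = -1])%R].
  exists w, s; split=> // x; apply: max_exp_le; first exact: max_exp_ge0.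
  move=> c cA.
  have [uv|uv] := sign_functionM hu hv c.
    have [p [pA ecp swp]] := Hp c cA uv.
    apply: le_trans (max_exp_ge _ pA); rewrite /move_along ler_expR lerD// uv.
    by rewrite [(s * (k * _))%R]mulrCA swp.
  have [p [pA ecp swp]] := Hn c cA uv.
  apply: le_trans (max_exp_ge _ pA); rewrite /move_along ler_expR lerD// uv.
  by rewrite [(s * (k * _))%R]mulrCA swp.
have [[p [pA /eqP uvp pmax]]|noP] := best [pred c | u c * v c == 1]%R;
  have [[n [nA /eqP uvn nmax]]|noN] := best [pred c | u c * v c == -1]%R.
(* If [u] agrees at [p] and [n], then [v] differs there; otherwise [u] itself separates them. The
   remaining cases have an empty sign class, where any direction with the right sign works. *)
- have [un|un] := eqVneq (u p) (u n).
    exists v, (v p); split; [by right|exact: hv| |].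
      move=> c cA /eqP uvc; exists p; split=> //; first exact: pmax.
      by rewrite -expr2; have [->|->] := hv p; rewrite ?sqrrN expr1n.
    move=> c cA /eqP uvc; exists n; split=> //; first exact: nmax.
    move: uvp uvn; rewrite -un; have [->|->] := hu p; rewrite ?mul1r ?mulN1r; first by move=> -> ->; rewrite mul1r.
    by move=> /eqP; rewrite eqr_oppLR => /eqP -> /eqP; rewrite eqr_opp => /eqP ->; rewrite mulr1.
  exists u, (u p); split; [by left|exact: hu| |].
    move=> c cA /eqP uvc; exists p; split=> //; first exact: pmax.
    by rewrite -expr2; have [->|->] := hu p; rewrite ?sqrrN expr1n.
  move=> c cA /eqP uvc; exists n; split=> //; first exact: nmax.
  move: un; have [->|->] := hu p; have [->|->] := hu n; rewrite ?eqxx// => _;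
    by rewrite ?mul1r ?mulr1.
- exists u, (u p); split; [by left|exact: hu| |].
    move=> c cA /eqP uvc; exists p; split=> //; first exact: pmax.
    by rewrite -expr2; have [->|->] := hu p; rewrite ?sqrrN expr1n.
  by move=> c cA /eqP uvc; have := noN c cA; rewrite /= uvc.
- exists u, (- u n)%R; split; [by left| | |].
  + by have [->|->] := hu n; rewrite ?opprK; [right|left].
  + by move=> c cA /eqP uvc; have := noP c cA; rewrite /= uvc.
  + move=> c cA /eqP uvc; exists n; split=> //; first exact: nmax.
    by rewrite mulNr -expr2; have [->|->] := hu n; rewrite ?sqrrN expr1n.
- exists u, 1%R; split; [by left|by left| |].
  + by move=> c cA /eqP uvc; have := noP c cA; rewrite /= uvc.
  + by move=> c cA /eqP uvc; have := noN c cA; rewrite /= uvc.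
Qed.

(* Elementary substitute for the Sudakov-Fernique inequality: the two optimal
   configurations with [u v = 1] and [u v = -1] differ in [u] or in [v], and
   averaging over the other Gaussian only increases the maximum. *)
Lemma average_sign_product (k : R) u v e : sign_function u -> sign_function v ->
  average (fun c => k * (u c * v c))%R (EFin \o max_exp) e <=
  average (fun c => k * u c)%R (average (fun c => k * v c)%R (EFin \o max_exp)) e.
Proof.
move=> hu hv; set F := EFin \o max_exp.
have nF : nonneg_functional F := max_exp_nonneg.
have [w [s [hw hs H]]] := max_exp_sign_product k e hu hv.
apply: (@le_trans _ _ (average (fun c => k * w c)%R F e)).
  apply: (@le_trans _ _ (average (fun c => s * (k * w c))%R F e)).
    apply: le_integral_nonneg_measurable; [exact: nonneg_measurable_line|exact: nonneg_measurable_line|].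
    by move=> x; rewrite lee_fin; exact: H.
  have [->|->] := hs.
    by rewrite (_ : (fun c => _) = (fun c => k * w c)%R)//; apply/funext => c; rewrite mul1r.
  rewrite (_ : (fun c => -1 * _)%R = (fun c => - (k * w c))%R) ?averageN//.
  by apply/funext => c; rewrite mulN1r.
have nA a := average_nonneg a nF.
have [->|->] := hw.
  by apply: le_average => // e'; exact: le_average_max_exp.
by rewrite averageC//; apply: le_average => // e'; exact: le_average_max_exp.
Qed.

Lemma average_sign_word (J : Type) (k : R) (s : J -> C -> R) (j : J) (w : seq J) e :
  (forall j, sign_function (s j)) ->
  average (fun c => k * \prod_(i <- j :: w) s i c)%R (EFin \o max_exp) e <=
  averages [seq (fun c => k * s i c)%R | i <- j :: w] (EFin \o max_exp) e.
Proof.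
move=> hs; have nF := max_exp_nonneg.
elim: w j e => [|i w IH] j e.
  by under [X in average X]eq_fun do rewrite big_seq1.
have hw : sign_function (fun c => \prod_(i <- i :: w) s i c)%R.
  elim: (i :: w) => [|l w' hw'] c; first by rewrite big_nil; left.
  by rewrite big_cons; exact: (sign_functionM (hs l) hw').
under [X in average X]eq_fun do rewrite big_cons.
apply: le_trans (average_sign_product k e (hs j) hw) _.
rewrite -[X in _ <= X]/(average (fun c => k * s j c)%R
  (averages [seq (fun c => k * s i0 c)%R | i0 <- i :: w] (EFin \o max_exp)) e).
apply: le_average; [exact: average_nonneg|exact: averages_nonneg|].
by move=> e'; exact: IH.
Qed.

(** The monomial field becomes a linear one, with a fresh Gaussian for each letter of each word.
    Words must be nonempty: the empty product is the constant 1, whose Gaussian would have no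
    counterpart on the right. *)
Lemma averages_sign_words (J : eqType) (k : seq J -> R) (s : J -> C -> R)
    (L : seq (seq J)) e :
  (forall j, sign_function (s j)) -> (forall w, w \in L -> w != [::]) ->
  averages [seq (fun c => k w * \prod_(i <- w) s i c)%R | w <- L] (EFin \o max_exp) e <=
  averages (flatten [seq [seq (fun c => k w * s i c)%R | i <- w] | w <- L])
    (EFin \o max_exp) e.
Proof.
move=> hs; have nF := max_exp_nonneg.
elim: L e => [|w L IH] e hL //=; rewrite averages_cat.
have nA D := averages_nonneg D nF.
set D := [seq _ | i <- L]; set D' := flatten _.
apply: (@le_trans _ _ (average (fun c => k w * \prod_(i <- w) s i c)%R (averages D' (EFin \o max_exp)) e)).
  apply: le_average => // e'; apply: IH => w' w'L; apply: hL.
  by rewrite inE w'L orbT.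
rewrite -averages_average// averagesC//.
apply: le_averages => //; first exact: average_nonneg.
move=> e'; have := hL w; rewrite mem_head => /(_ isT).
by case: (w) => // j w' _; exact: average_sign_word.
Qed.

End max_exp.

End planted.

(** * Gaussian averages of products over sites *)

Section coordinates.
Context {R : realType} {J : finType}.
Local Notation gam := (@std_normal R).
Local Open Scope ereal_scope.
Implicit Types (f : R -> \bar R) (v : J -> R).

Definition nonneg_measurable_real f := @nonneg_measurable R _ (measurableTypeR R) f.

Definition gaussian_smooth (r : R) f (y : R) : \bar R := \int[gam]_x f (y + r * x)%R.

Lemma gaussian_smooth0 f y : gaussian_smooth 0 f y = f y.
Proof.
rewrite /gaussian_smooth; under eq_integral do rewrite mul0r addr0.
exact: integral_std_normal_cst.
Qed.

Lemma gaussian_smooth_nonneg r f : nonneg_measurable_real f ->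
  nonneg_measurable_real (gaussian_smooth r f).
Proof.
move=> [mf f0]; split; last by move=> y; exact: integral_ge0.
pose g (z : R * R) := f (z.1 + r * z.2)%R.
have mg : measurable_fun setT g.
  apply: measurableT_comp => //; apply: measurable_funD => //.
  exact: measurable_funM.
exact: (@measurable_fun_fubini_tonelli_F _ _ (measurableTypeR R) (measurableTypeR R) R gam g mg (fun=> f0 _)).
Qed.

Lemma gaussian_smooth_smooth r s f y : nonneg_measurable_real f ->
  \int[gam]_x gaussian_smooth r f (y + x * s)%R =
  gaussian_smooth (Num.sqrt (r ^+ 2 + s ^+ 2)) f y.
Proof.
move=> [mf f0].
have mfy : measurable_fun [set: R] (fun x => f (y + x)%R).
  by apply: measurableT_comp => //; exact: measurable_funD.
have := @ge0_integral_std_normalD R s r (fun x => f (y + x)%R) mfy (fun=> f0 _).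
move=> H; rewrite /gaussian_smooth [(r ^+ 2 + _)%R]addrC -H.
apply: eq_integral => x _; apply: eq_integral => z _.
by rewrite addrA [(x * s)%R]mulrC.
Qed.

Variable theta : J -> R -> \bar R.
Hypothesis theta_nonneg : forall j, nonneg_measurable_real (theta j).

(** The mean of [prod_j theta_j (h_j + sqrt (v_j) g_j)]. It is indexed by variances because
    successive moves along one coordinate just add theirs to [v_j]. *)
Definition smooth_product v (h : J -> R) : \bar R :=
  \prod_(j : J) gaussian_smooth (Num.sqrt (v j)) (theta j) (h j).

Lemma smooth_product_nonneg v : nonneg_functional (smooth_product v).
Proof.
have H s : nonneg_functional (fun h : J -> R =>
    \prod_(j <- s) gaussian_smooth (Num.sqrt (v j)) (theta j) (h j)).
  elim: s => [|j s IH].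
    rewrite (_ : (fun h => _) = (fun=> 1)); first exact: (nonneg_functional_cst ler01).
    by apply/funext => h; rewrite big_nil.
  rewrite (_ : (fun h => _) = (fun h => gaussian_smooth (Num.sqrt (v j)) (theta j) (h j) *
     \prod_(j <- s) gaussian_smooth (Num.sqrt (v j)) (theta j) (h j))); last first.
    by apply/funext => h; rewrite big_cons.
  apply: nonneg_functionalM => //.
  have [m0 n0] := gaussian_smooth_nonneg (Num.sqrt (v j)) (theta_nonneg j).
  split=> [d T f mf|h]; last exact: n0.
  exact: (measurableT_comp m0 (mf j)).
exact: H.
Qed.

Definition coordinate (c : R) (j : J) : J -> R := fun i => (c * (i == j)%:R)%R.

Lemma average_smooth_product v (c : R) (j : J) : (forall i, 0 <= v i)%R ->
  average (coordinate c j) (smooth_product v) =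
  smooth_product (fun i => v i + (i == j)%:R * c ^+ 2)%R.
Proof.
move=> v0; apply/funext => h; rewrite /average /smooth_product.
set rest := \prod_(i | i != j) gaussian_smooth (Num.sqrt (v i)) (theta i) (h i).
have r0 : 0 <= rest.
  rewrite /rest; elim/big_ind: _ => // [? ?|i _]; first exact: mule_ge0.
  exact: (gaussian_smooth_nonneg _ (theta_nonneg i)).2.
have nS := gaussian_smooth_nonneg (Num.sqrt (v j)) (theta_nonneg j).
transitivity (\int[gam]_x (gaussian_smooth (Num.sqrt (v j)) (theta j) (h j + x * c)%R * rest)).
  apply: eq_integral => x _; rewrite (bigD1 j)//= /move_along /coordinate eqxx mulr1.
  congr (_ * _); apply: eq_bigr => i /negPf ij.
  by rewrite ij !mulr0 addr0.
rewrite integral_nonneg_measurableZr//; last first.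
  split; last by move=> x; exact: nS.2.
  apply: (measurableT_comp nS.1); apply: measurable_funD => //.
  exact: measurable_funM.
rewrite (gaussian_smooth_smooth _ _ _ (theta_nonneg j)) (sqr_sqrtr (v0 j)).
transitivity (gaussian_smooth (Num.sqrt (v j + (j == j)%:R * c ^+ 2)) (theta j) (h j) * rest).
  by rewrite eqxx (mul1r (c ^+ 2)%R).
rewrite [RHS](bigD1 j isT).
congr (_ * _).
apply: eq_bigr => i /negPf ij.
by rewrite ij (mul0r (c ^+ 2)%R) (addr0 (v i)).
Qed.

Lemma averages_smooth_product (L : seq (R * J)) v : (forall i, 0 <= v i)%R ->
  averages [seq coordinate p.1 p.2 | p <- L] (smooth_product v) =
  smooth_product (fun i => v i + \sum_(p <- L | p.2 == i) p.1 ^+ 2)%R.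
Proof.
move=> v0; elim: L => [|p L IH] /=.
  by congr smooth_product; apply/funext => i; rewrite big_nil addr0.
rewrite IH average_smooth_product; last first.
  by move=> i; rewrite addr_ge0// sumr_ge0// => q _; exact: sqr_ge0.
congr smooth_product; apply/funext => i; rewrite big_cons eq_sym.
case: eqP => _; first by rewrite mul1r addrAC addrA.
by rewrite mul0r addr0.
Qed.

End coordinates.

(** * The normal distribution function and the mean of [|g - b|] *)

Section gaussian_estimates.
Context {R : realType}.
Local Notation gam := (@std_normal R).
Local Notation mu := (@lebesgue_measure R).
Local Open Scope ereal_scope.

Lemma PhiE (x : R) : (Phi x)%:E = gam `]-oo, x]%classic.
Proof.
rewrite /Phi std_normalE fineK//.
by rewrite -std_normalE fin_num_measure.
Qed.

Lemma Phi_lipschitz (x y : R) : (x <= y)%R ->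
  (0 <= Phi y - Phi x <= normal_peak 1 * (y - x))%R.
Proof.
move=> xy.
have E : (Phi y)%:E = (Phi x)%:E + gam `]x, y]%classic.
  rewrite !PhiE -measureU//.
    by congr (gam _); rewrite -itv_bndbnd_setU//= bnd_simp.
  apply/seteqP; split => z //=; rewrite !in_itv/= => -[z1 /andP[z2 _]].
  by move: (lt_le_trans z2 z1); rewrite ltxx.
have gE : gam `]x, y]%classic = (Phi y - Phi x)%:E by rewrite EFinB E addeAC subee// add0e.
rewrite -!lee_fin -gE; apply/andP; split; first exact: measure_ge0.
rewrite std_normalE /normal_prob.
apply: (@le_trans _ _ (\int[mu]_(z in `]x, y]) (normal_peak 1)%:E)).
  apply: ge0_le_integral => //.
  - by move=> z _; rewrite lee_fin normal_pdf_ge0.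
  - by apply/measurable_EFinP; apply: measurable_funTS; exact: measurable_normal_pdf.
  - by move=> z _; rewrite lee_fin normal_pdf_ub.
rewrite integral_cst//= lebesgue_measure_itv/= lte_fin; case: ifP => xy'.
  by rewrite -EFinB -EFinM.
by rewrite mule0 lee_fin mulr_ge0 ?normal_peak_ge0// subr_ge0.
Qed.

Lemma continuous_Phi : continuous (@Phi R).
Proof.
have k0 := normal_peak_gt0 (oner_neq0 R).
move=> x; apply/cvgrPdist_le => e e0; near=> y.
apply: (@le_trans _ _ (normal_peak 1 * `|x - y|)%R).
  have [xy|/ltW yx] := leP x y.
    have /andP[h1 h2] := Phi_lipschitz xy.
    by rewrite distrC ger0_norm// distrC ger0_norm ?subr_ge0.
  have /andP[h1 h2] := Phi_lipschitz yx.
  by rewrite ger0_norm// ger0_norm ?subr_ge0.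
rewrite mulrC -ler_pdivlMr//; near: y.
by apply: cvgr_dist_le => //; rewrite divr_gt0.
Unshelve. all: by end_near. Qed.

Lemma cvg_Phi : Phi x @[x --> +oo%R] --> (1 : R)%R /\ Phi x @[x --> -oo%R] --> (0 : R)%R.
Proof.
have mid : measurable_fun [set: measurableTypeR R] (id : measurableTypeR R -> R).
  exact: measurable_id.
pose idR : {RV gam >-> R} := mfun_of mid.
have E : @Phi R = fine \o cdf (idR : {RV gam >-> R}).
  apply/funext => x; rewrite /= /cdf /distribution /pushforward/= /Phi std_normalE.
  by [].
split; rewrite E; apply: fine_cvg; [exact: cvg_cdfy1|exact: cvg_cdfNy0].
Qed.

Lemma Phi_surj (y : R) : (0 < y < 1)%R -> exists x, Phi x = y.
Proof.
move=> /andP[y0 y1]; have [cy cNy] := cvg_Phi.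
have [b yb] : exists b, (y <= Phi b)%R.
  have : \forall b \near +oo%R, (y <= Phi b)%R by exact: cvgr_ge cy _ y1.
  by move=> /(@filter_ex _ _ _ _).
have [a ay] : exists a, (Phi a <= y)%R.
  have : \forall b \near -oo%R, (Phi b <= y)%R by exact: cvgr_le cNy _ y0.
  by move=> /(@filter_ex _ _ _ _).
have [ab|ba] := leP a b; last first.
  exists a; apply/eqP; rewrite eq_le ay /=.
  have /andP[h1 _] := Phi_lipschitz (ltW ba).
  by apply: le_trans yb _; rewrite -subr_ge0.
have cP : {within `[a, b], continuous (@Phi R)}.
  by apply: continuous_subspaceT; exact: continuous_Phi.
have [|x _ <-] := IVT ab cP (v := y); last by exists x.
by rewrite min_l ?max_r ?ay ?yb//; exact: le_trans yb.
Qed.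

Lemma Phi_invK (y : R) : (0 < y < 1)%R -> Phi (Phi_inv y) = y.
Proof.
move=> /Phi_surj[x xy]; rewrite /Phi_inv pinvK// inE.
by exists x.
Qed.

(** If [b < 0], the half-lines below [b] and above [-b] are disjoint and have the same mass, so
    [2 Phi b <= 1]. *)
Lemma Phi_gt_half (b : R) : (2^-1 < Phi b)%R -> (0 <= b)%R.
Proof.
rewrite leNgt; apply: contraPN => b0; apply/negP; rewrite -leNgt.
have : gam `]-oo, b]%classic + gam `]-oo, b]%classic <= 1.
  have -> : gam `]-oo, b]%classic + gam `]-oo, b]%classic = gam `]-oo, b]%classic + gam `[(- b)%R, +oo[%classic.
    congr (_ + _).
    have gE (A : set R) : measurable A -> gam A = \int[gam]_x (\1_A x)%:E.
      by move=> mA; rewrite integral_indic// setIT.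
    rewrite (gE `]-oo, b]%classic)// (gE `[(- b)%R, +oo[%classic)//.
    rewrite -[RHS]ge0_integral_std_normal_oppr; last 2 first.
    - exact/measurable_EFinP.
    - by move=> x; rewrite lee_fin.
    apply: eq_integral => x _; rewrite !indicE; congr (_%:R%:E).
    by rewrite !mem_setE/= !in_itv/= andbT lerN2.
  rewrite -measureU//; last first.
    apply/seteqP; split => z //=; rewrite !in_itv/= andbT => -[z1 z2].
    by move: (le_trans z2 z1) b0; lra.
  by apply: (probability_le1 gam); exact: measurableU.
by rewrite -PhiE -EFinD lee_fin; lra.
Qed.

(** The derivative of [- phi] is [x phi x], and [phi] vanishes at infinity. *)
Lemma integral_id_normal_pdf (b : R) : (0 <= b)%R ->
  \int[mu]_(x in `[b, +oo[) (x * normal_pdf 0 1 x)%:E = (normal_pdf 0 1 b)%:E.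
Proof.
move=> b0.
have pE x : normal_pdf 0 1 x = (normal_peak 1 * expR (- x ^+ 2 / 2))%R :> R.
  by rewrite normal_pdfE//= /normal_fun subr0 expr1n.
have dF (x : R) : is_derive x (1%R:R) (fun x => - normal_pdf 0 1 x)%R (x * normal_pdf 0 1 x)%R.
  rewrite (_ : (fun x => _) = (fun x => - (normal_peak 1 * expR (- x ^+ 2 / 2)))%R); last first.
    by apply/funext => z; rewrite pE.
  apply: is_derive_eq.
  by rewrite pE /GRing.scale/=; field.
rewrite (@ge0_continuous_FTC2y R (fun x => x * normal_pdf 0 1 x)%R (fun x => - normal_pdf 0 1 x)%R b 0%R).
- by rewrite sub0e EFinN oppeK.
- by move=> x bx; rewrite mulr_ge0 ?normal_pdf_ge0//; exact: le_trans bx.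
- apply: continuous_subspaceT => x; apply: cvgM; first exact: cvg_id.
  by apply: continuous_normal_pdf.
- rewrite -[X in _ --> X]oppr0; apply: cvgN.
  apply: (@squeeze_cvgr _ _ _ _ (cst 0%R) (fun x => normal_peak 1 * expR 2^-1 * expR (- x))%R).
  (* The majorant comes from [(x - 1)^2 >= 0], that is [- x^2 / 2 <= 1/2 - x]. *)
  + near=> x; rewrite normal_pdf_ge0 pE -mulrA -expRD ler_wpM2l ?normal_peak_ge0//.
    by rewrite ler_expR; have := sqr_ge0 (x - 1)%R; rewrite sqrrB1; lra.
  + exact: cvg_cst.
  + rewrite -[X in _ --> X](mulr0 (normal_peak 1 * expR 2^-1)%R).
    by apply: cvgMr; exact: cvgr_expR.
- by move=> x _; exact: (@ex_derive _ _ _ _ _ _ _ (dF x)).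
- apply: cvgN; apply: cvg_at_right_filter; exact: continuous_normal_pdf.
- by move=> x _; rewrite derive1E; exact: (@derive_val _ _ _ _ _ _ _ (dF x)).
Unshelve. all: by end_near. Qed.

(** Integrate [|x - b| + x^+ = 2 (x - b)^+ + b + (-x)^+], all of whose terms are nonnegative since
    [b >= 0]; the means of [x^+] and [(-x)^+] cancel by symmetry. Splitting [x = (x - b) + b] in the
    integral of [x phi x] over [[b, +oo[] gives the mean of [(x - b)^+]. *)
Lemma integral_dist_std_normal (b : R) : (2^-1 < Phi b)%R ->
  \int[gam]_x (`|x - b|)%:E <= (2 * normal_pdf 0 1 b + b * (2 * Phi b - 1))%:E.
Proof.
move=> /[dup] Pb /Phi_gt_half b0.
have nm (f : R -> R) : measurable_fun [set: R] f -> (forall x, 0 <= f x)%R ->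
    @nonneg_measurable R _ (measurableTypeR R) (fun x => (f x)%:E).
  by move=> mf f0; split; first exact/measurable_EFinP.
pose p (x : R) := Num.max x 0%R.
have p0 x : (0 <= p x)%R by rewrite le_max lexx orbT.
have mp : measurable_fun [set: R] p by exact: measurable_maxr.
have np : @nonneg_measurable R _ (measurableTypeR R) (fun x => (p x)%:E) by exact: nm.
have npN : @nonneg_measurable R _ (measurableTypeR R) (fun x => (p (- x))%:E).
  by apply: nm => //; exact: measurableT_comp.
have npb : @nonneg_measurable R _ (measurableTypeR R) (fun x => (p (x - b))%:E).
  by apply: nm => //; apply: measurableT_comp => //; exact: measurable_funB.
have nd : @nonneg_measurable R _ (measurableTypeR R) (fun x => (`|x - b|)%:E).
  by apply: nm => //; apply: measurableT_comp => //; exact: measurable_funB.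
have nb : @nonneg_measurable R _ (measurableTypeR R) (fun=> b%:E).
  by apply: nonneg_measurable_cst; rewrite lee_fin.
pose I := `[b, +oo[%classic : set R.
have mI : measurable I by exact: measurable_itv.
have ni : @nonneg_measurable R _ (measurableTypeR R) (fun x => (\1_I x)%:E).
  by apply: nm => // ; exact: measurable_indic.
have tail : \int[gam]_x (p (x - b))%:E + b%:E * gam I = (normal_pdf 0 1 b)%:E.
  have b0' : 0 <= b%:E by rewrite lee_fin.
  rewrite -[I in gam I]setIT -integral_indic//.
  rewrite -(integral_nonneg_measurableZl gam b0' ni).
  rewrite -(integral_nonneg_measurableD gam npb (nonneg_measurableZ b0' ni)).
  rewrite -(integral_id_normal_pdf b0) ge0_integral_std_normal; last 2 first.
  - exact: (nonneg_measurableD npb (nonneg_measurableZ b0' ni)).1.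
  - exact: (nonneg_measurableD npb (nonneg_measurableZ b0' ni)).2.
  rewrite [RHS]integral_mkcond; apply: eq_integral => x _.
  rewrite patchE (_ : _ + _ = (p (x - b) + b * \1_I x)%:E)// -EFinM indicE /p.
  rewrite mem_setE /= in_itv/= andbT; case: leP => bx.
    by rewrite mulr1 max_l ?subr_ge0// subrK.
  by rewrite mulr0 addr0 max_r ?mul0r// subr_le0 ltW.
have gI : (1 - Phi b)%:E <= gam I.
  have : 1 <= gam `]-oo, b]%classic + gam I.
    rewrite -[X in X <= _](probability_setT gam).
    apply: le_trans (measureU2 _ _ _) => //.
    apply: le_measure; rewrite ?inE//; first exact: measurableU.
    move=> x _; have [xb|/ltW bx] := leP x b; [left|right]; rewrite /I/= in_itv/= ?andbT//.
  by rewrite -PhiE EFinB leeBlDl.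
have pos : \int[gam]_x (p x)%:E = \int[gam]_x (p (- x))%:E.
  by rewrite (ge0_integral_std_normal_oppr (f := fun x => (p x)%:E))//; exact: np.1.
have E : \int[gam]_x (`|x - b|)%:E + \int[gam]_x (p x)%:E =
    \int[gam]_x (p (x - b))%:E + \int[gam]_x (p (x - b))%:E + (b%:E + \int[gam]_x (p x)%:E).
  rewrite [in X in _ = _ + (_ + X)]pos -[b%:E in RHS]integral_std_normal_cst.
  rewrite -(integral_nonneg_measurableD gam nd np) -(integral_nonneg_measurableD gam npb npb).
  rewrite -(integral_nonneg_measurableD gam nb npN).
  rewrite -(integral_nonneg_measurableD gam (nonneg_measurableD npb npb) (nonneg_measurableD nb npN)).
  apply: eq_integral => x _; rewrite -!EFinD; congr EFin; rewrite /p.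
  have [bx|/ltW xb] := leP b x.
    rewrite ger0_norm ?subr_ge0// (max_l (x := x - b)%R) ?subr_ge0//.
    by rewrite max_l ?max_r ?oppr_le0; lra.
  rewrite ler0_norm ?subr_le0// (max_r (x := x - b)%R) ?subr_le0//.
  by case: (leP x 0%R) => x0; [rewrite max_l|rewrite max_r]; lra.
have pfin : \int[gam]_x (p x)%:E \is a fin_num.
  rewrite ge0_fin_numE; last exact: integral_nonneg_measurable_ge0.
  apply: (@le_lt_trans _ _ (\int[gam]_x (expR (1 * x))%:E)); last first.
    by rewrite integral_std_normal_expR ltry.
  apply: le_integral_nonneg_measurable => //.
    by apply: nonneg_measurable_expR; exact: measurable_funM.
  move=> x; rewrite lee_fin mul1r /p ge_max expR_ge0 andbT.
  by have := expR_ge1Dx x; lra.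
have tfin : \int[gam]_x (p (x - b))%:E \is a fin_num.
  rewrite ge0_fin_numE; last exact: integral_nonneg_measurable_ge0.
  apply: (@le_lt_trans _ _ (normal_pdf 0 1 b)%:E); last exact: ltry.
  by rewrite -tail leeDl// mule_ge0// lee_fin.
move: E tail; rewrite -(fineK pfin) -(fineK tfin).
have gIfin : gam I \is a fin_num by exact: fin_num_measure.
move: gI; rewrite -(fineK gIfin); set P := fine _; set t := fine _; set g := fine _.
rewrite lee_fin -EFinM => gP.
move=> E; rewrite -EFinD => -[tail].
have bP : (b * (1 - Phi b) <= b * P)%R by rewrite ler_wpM2l.
rewrite -(@leeD2rE _ t%:E)// E -!EFinD lee_fin.
by lra.
Qed.

Lemma integral_expR_dist_std_normal (b : R) : (2^-1 < Phi b)%R ->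
  exists2 K : R, (0 <= K)%R & forall tau, (0 <= tau <= 1)%R ->
  \int[gam]_x (expR (tau * `|x - b|))%:E <=
  (expR (tau * (2 * normal_pdf 0 1 b + b * (2 * Phi b - 1)) + K * tau ^+ 2))%:E.
Proof.
move=> Pb; pose u := expR (2 * b); pose v := expR (- 2 * b).
have u0 : (0 <= u)%R by exact: expR_ge0.
have v0 : (0 <= v)%R by exact: expR_ge0.
(* With [y = |x - b|], one has [exp (tau y) <= 1 + tau y + (tau y)^2 exp (tau y)], [y^2 <= 4 exp y],
   and [exp (2 y)] is at most [exp (2 (x - b)) + exp (-2 (x - b))]. [K] is 4 times the mean of this
   last sum, so it does not depend on [tau]. *)
pose K := (4 * (v * expR (2 ^+ 2 / 2) + u * expR ((-2) ^+ 2 / 2)))%R.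
exists K; first by rewrite mulr_ge0// addr_ge0// mulr_ge0// expR_ge0.
move=> tau /andP[tau0 tau1].
have nX (k : R) : @nonneg_measurable R _ (measurableTypeR R) (fun x => (expR (k * x))%:E).
  by apply: nonneg_measurable_expR; exact: measurable_funM.
have mdist : measurable_fun [set: R] (fun x : R => `|x - b|)%R.
  by apply: measurableT_comp => //; exact: measurable_funB.
have nd : @nonneg_measurable R _ (measurableTypeR R) (fun x => (`|x - b|)%:E).
  exact: nonneg_measurable_EFin.
have nT : @nonneg_measurable R _ (measurableTypeR R) (fun x => (expR (tau * `|x - b|))%:E).
  by apply: nonneg_measurable_expR; exact: measurable_funM.
have tau0' : 0 <= tau%:E by rewrite lee_fin.
have t2 : 0 <= (4 * tau ^+ 2)%:E by rewrite lee_fin mulr_ge0// sqr_ge0.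
have v0' : 0 <= v%:E by rewrite lee_fin.
have u0' : 0 <= u%:E by rewrite lee_fin.
have n1 := @nonneg_measurable_cst R _ (measurableTypeR R) _ (@lee01 R).
have nV := nonneg_measurableZ v0' (nX 2%R).
have nU := nonneg_measurableZ u0' (nX (-2)%R).
have nVU := nonneg_measurableD nV nU.
have n2 := nonneg_measurableZ t2 nVU.
have n3 := nonneg_measurableZ tau0' nd.
have n12 := nonneg_measurableD n1 n3.
have H x : (expR (tau * `|x - b|))%:E <= (1 + tau%:E * (`|x - b|)%:E) +
    (4 * tau ^+ 2)%:E * (v%:E * (expR (2 * x))%:E + u%:E * (expR (-2 * x))%:E).
  rewrite [leRHS](_ : _ = (1 + tau * `|x - b| +
    4 * tau ^+ 2 * (v * expR (2 * x) + u * expR (-2 * x)))%:E)// lee_fin.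
  set y := `|x - b|%R.
  have y0 : (0 <= y)%R by exact: normr_ge0.
  have step1 : (expR (tau * y) <= 1 + tau * y + (tau * y) ^+ 2 * expR (tau * y))%R.
    have := expR_ge1Dx (- (tau * y))%R; rewrite expRN => h.
    have e0 := expR_gt0 (tau * y)%R.
    have ty0 : (0 <= tau * y)%R by exact: mulr_ge0.
    have : ((1 - tau * y) * expR (tau * y) <= 1)%R by rewrite -ler_pdivlMr// mul1r.
    by nra.
  have step2 : (y ^+ 2 <= 4 * expR y)%R.
    have := expR_ge1Dx (y / 2)%R => h.
    have -> : (expR y = expR (y / 2) * expR (y / 2))%R by rewrite -expRD; congr expR; field.
    by nra.
  have step3 : (expR (tau * y) <= expR y)%R by rewrite ler_expR ler_piMl.
  have step4 : (expR y * expR y <= v * expR (2 * x) + u * expR (-2 * x))%R.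
    rewrite /u /v -!expRD /y; case: (ger0P (x - b)%R) => xb.
      rewrite (_ : x - b + (x - b) = -2 * b + 2 * x)%R; last by ring.
      by rewrite lerDl expR_ge0.
    rewrite (_ : - (x - b) - (x - b) = 2 * b + -2 * x)%R; last by ring.
    by rewrite lerDr expR_ge0.
  have step5 : (y ^+ 2 * expR (tau * y) <= 4 * (v * expR (2 * x) + u * expR (-2 * x)))%R.
    apply: (@le_trans _ _ (4 * expR y * expR y)%R).
      by rewrite ler_pM ?sqr_ge0 ?expR_ge0.
    by rewrite -mulrA ler_wpM2l.
  apply: (le_trans step1); rewrite lerD2l exprMn [(4 * _)%R]mulrC.
  by rewrite -[leLHS]mulrA -[leRHS]mulrA ler_wpM2l ?sqr_ge0.
have := le_integral_nonneg_measurable gam nT (nonneg_measurableD n12 n2) H.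
rewrite (integral_nonneg_measurableD gam n12 n2) (integral_nonneg_measurableD gam n1 n3).
rewrite (integral_nonneg_measurableZl gam t2 nVU) (integral_nonneg_measurableD gam nV nU).
rewrite (integral_nonneg_measurableZl gam v0' (nX _)) (integral_nonneg_measurableZl gam u0' (nX _)).
rewrite (integral_nonneg_measurableZl gam tau0' nd) (integral_std_normal_expR 2) (integral_std_normal_expR (-2)).
rewrite (integral_std_normal_cst 1).
move=> /le_trans; apply.
set M := (2 * _ + _)%R.
have dM := lee_wpmul2l tau0' (integral_dist_std_normal Pb).
apply: (@le_trans _ _ (1 + tau * M + K * tau ^+ 2)%:E).
  rewrite !EFinD leeD//; first by rewrite leeD2l// EFinM.
  by rewrite lee_fin /K le_eqVlt; apply/orP; left; apply/eqP; ring.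
rewrite lee_fin; apply: le_trans (expR_ge1Dx _).
by rewrite addrA.
Qed.

End gaussian_estimates.

(** * Covariance structure of the Hamiltonian *)

Section interactions.
Context {R : realType} (P : nat) (gamma : nat -> R) (N : nat).

Definition interactions : seq (seq 'I_N) :=
  flatten [seq [seq tval t | t <- enum {: k.-tuple 'I_N}] | k <- index_iota 2 P.+1].

Definition interaction_strength (w : seq 'I_N) : R :=
  gamma (size w) / N%:R `^ (((size w)%:R - 1) / 2).

Definition spin_product (s : config N) (w : seq 'I_N) : R := \prod_(j <- w) spin s j.

Lemma mem_interactions w : w \in interactions -> (2 <= size w <= P)%N.
Proof.
move=> /flattenP[_ /mapP[k + ->] /mapP[t _ ->]].
by rewrite mem_index_iota size_tuple ltnS.
Qed.

Lemma uniq_interactions : uniq interactions.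
Proof.
rewrite /interactions; have : uniq (index_iota 2 P.+1) by exact: iota_uniq.
elim: (index_iota _ _) => //= k ks IH /andP[kks uks].
rewrite cat_uniq IH// andbT map_inj_uniq ?enum_uniq//=; last exact: val_inj.
apply/hasPn => w /flattenP[_ /mapP[m mks ->] /mapP[t _ ->]].
apply/mapP => -[u _ tu]; move: kks; rewrite -(size_tuple u) -tu size_tuple.
by rewrite mks.
Qed.

Lemma big_interactions (f : seq 'I_N -> R) :
  \sum_(w <- interactions) f w = \sum_(2 <= k < P.+1) \sum_(t : k.-tuple 'I_N) f t.
Proof.
rewrite /interactions big_flatten big_map; apply: eq_bigr => k _.
by rewrite big_map big_enum.
Qed.

Lemma hamiltonianE (g : seq 'I_N -> R) (s : config N) :
  hamiltonian P gamma g s =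
  \sum_(w <- interactions) g w * (interaction_strength w * spin_product s w).
Proof.
rewrite big_interactions; apply: eq_bigr => k _; rewrite mulr_sumr.
apply: eq_bigr => t _; rewrite /interaction_strength size_tuple /spin_product.
by rewrite mulrCA.
Qed.

Lemma sum_tuple_prod (k : nat) (F : 'I_k -> 'I_N -> R) :
  \sum_(t : k.-tuple 'I_N) \prod_(m < k) F m (tnth t m) =
  \prod_(m < k) \sum_(j < N) F m j.
Proof.
rewrite bigA_distr_bigA /= (reindex (@tuple_of_finfun _ _)); last first.
  by exists (@finfun_of_tuple _ _) => x _; [exact: tuple_of_finfunK|exact: finfun_of_tupleK].
apply: eq_bigr => f _; apply: eq_bigr => m _.
by rewrite tnth_mktuple.
Qed.

Lemma interaction_strength_sqr (k : nat) (t : k.-tuple 'I_N) : (0 < k)%N ->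
  interaction_strength t ^+ 2 = gamma k ^+ 2 / N%:R ^+ k.-1.
Proof.
move=> k0; rewrite /interaction_strength size_tuple expr_div_n; congr (_ / _).
rewrite -powR_mulrn ?powR_ge0// -powRrM divfK ?pnatr_eq0// -powR_mulrn//.
by congr (_ `^ _); rewrite -{1}(prednK k0) -natr1 addrK.
Qed.

Lemma mixtureE (x : R) : (mixture P gamma).[x] = \sum_(2 <= k < P.+1) gamma k ^+ 2 * x ^+ k.
Proof. by rewrite /mixture horner_sum; apply: eq_bigr => k _; rewrite hornerZ hornerXn. Qed.

Lemma mixture_deriv1 :
  (mixture P gamma)^`().[1] = \sum_(2 <= k < P.+1) gamma k ^+ 2 * k%:R.
Proof.
rewrite /mixture raddf_sum /= horner_sum; apply: eq_bigr => k _.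
by rewrite derivZ derivXn hornerZ hornerMn hornerXn expr1n.
Qed.

(** The sum over words of length [k] factors into [(sum_j x_j)^k], which the normalization [N^(k-1)]
    turns into [N] times a power of the mean. Taking [x_j = s_j t_j] gives the covariance, and
    [x = 1] the variance. *)
Lemma interactions_covariance (x : 'I_N -> R) : (0 < N)%N ->
  \sum_(w <- interactions) interaction_strength w ^+ 2 * \prod_(j <- w) x j =
  N%:R * (mixture P gamma).[(\sum_(j < N) x j) / N%:R].
Proof.
move=> N0; have N0' : N%:R != 0 :> R by rewrite pnatr_eq0 -lt0n.
rewrite big_interactions mixtureE mulr_sumr.
apply: eq_big_nat => k /andP[k2 _]; have k0 : (0 < k)%N by exact: ltn_trans k2.
transitivity (gamma k ^+ 2 / N%:R ^+ k.-1 * \sum_(t : k.-tuple 'I_N) \prod_(j <- t) x j).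
  by rewrite mulr_sumr; apply: eq_bigr => t _; rewrite interaction_strength_sqr.
under eq_bigr do rewrite big_tuple.
rewrite (sum_tuple_prod (fun=> x)) prodr_const card_ord expr_div_n.
have -> : N%:R ^+ k = N%:R * N%:R ^+ k.-1 :> R by rewrite -exprS prednK.
by field; rewrite N0' expf_neq0.
Qed.

(** Each of the [k] positions carries the letter [i] in [N^(k-1)] words, which cancels the
    normalization and leaves [k gamma_k^2]. *)
Lemma interactions_degree (i : 'I_N) : (0 < N)%N ->
  \sum_(w <- interactions) interaction_strength w ^+ 2 * (count_mem i w)%:R =
  (mixture P gamma)^`().[1].
Proof.
move=> N0; have N0' : N%:R != 0 :> R by rewrite pnatr_eq0 -lt0n.
rewrite big_interactions mixture_deriv1.
apply: eq_big_nat => k /andP[k2 _]; have k0 : (0 < k)%N by exact: ltn_trans k2.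
transitivity (gamma k ^+ 2 / N%:R ^+ k.-1 * \sum_(t : k.-tuple 'I_N) (count_mem i t)%:R).
  by rewrite mulr_sumr; apply: eq_bigr => t _; rewrite interaction_strength_sqr.
have -> : \sum_(t : k.-tuple 'I_N) (count_mem i t)%:R =
    \sum_(m < k) \sum_(t : k.-tuple 'I_N) (tnth t m == i)%:R :> R.
  rewrite exchange_big; apply: eq_bigr => t _.
  rewrite -sum1_count natr_sum big_mkcond big_tuple.
  by apply: eq_bigr => m _ /=; case: ifP.
have E (m : 'I_k) : \sum_(t : k.-tuple 'I_N) (tnth t m == i)%:R = N%:R ^+ k.-1 :> R.
  (* The indicator for position [m] is padded by factors 1 at the other positions, so that the sum
     over words factors. *)
  transitivity (\sum_(t : k.-tuple 'I_N) \prod_(m' < k)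
      (if m' == m then (tnth t m' == i)%:R else 1) : R).
    apply: eq_bigr => t _; rewrite (bigD1 m)//= eqxx big1 ?mulr1//.
    by move=> m' /negPf ->.
  rewrite (sum_tuple_prod (fun m' j => if m' == m then (j == i)%:R else 1)).
  rewrite (bigD1 m)//= eqxx (bigD1 i)//= eqxx big1 ?addr0 ?mul1r; last by move=> j /negPf ->.
  transitivity (\prod_(m' < k | m' != m) (N%:R : R)).
    by apply: eq_bigr => m' /negPf ->; rewrite sumr_const card_ord.
  by rewrite prodr_const cardC1 card_ord.
rewrite (eq_bigr (fun=> N%:R ^+ k.-1)) ?sumr_const ?card_ord; last by move=> m _; exact: E.
by rewrite -[X in _ * X]mulr_natr mulrA divfK ?expf_neq0.
Qed.

Lemma spin_sqr (s : config N) j : spin s j ^+ 2 = 1 :> R.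
Proof. by rewrite /spin -exprM mulnC exprM sqrrN !expr1n. Qed.

Lemma spin_product_sqr (s : config N) w : spin_product s w ^+ 2 = 1.
Proof. by rewrite /spin_product -prodrXl big1// => j _; rewrite spin_sqr. Qed.

Lemma interactions_overlap (s t : config N) : (0 < N)%N ->
  \sum_(w <- interactions)
    interaction_strength w ^+ 2 * (spin_product s w * spin_product t w) =
  N%:R * (mixture P gamma).[inner s t / N%:R].
Proof.
move=> N0; rewrite -interactions_covariance//; apply: eq_bigr => w _.
by rewrite /spin_product -big_split.
Qed.

Lemma interactions_variance : (0 < N)%N ->
  \sum_(w <- interactions) interaction_strength w ^+ 2 = N%:R * (mixture P gamma).[1].
Proof.
move=> N0; have N0' : N%:R != 0 :> R by rewrite pnatr_eq0 -lt0n.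
have := interactions_covariance (fun=> 1) N0.
rewrite sumr_const card_ord -[1 *+ N]/(N%:R) divff// => <-.
by apply: eq_bigr => w _; rewrite big1 ?mulr1.
Qed.

End interactions.

(** * First-moment bound on a slice around a planted configuration *)

Section planted_bound.
Context {R : realType} (P : nat) (gamma : nat -> R) (N : nat).
Hypothesis N0 : (0 < N)%N.
Local Notation gam := (@std_normal R).
Local Notation l := (interactions P N).
Local Notation str := (interaction_strength gamma).
Local Notation xi := (mixture P gamma).

Definition overlap_slice (s : config N) (ql qu : R) : {set config N} :=
  [set t | ql <= inner s t / N%:R <= qu].

Lemma spin_sign (j : 'I_N) : sign_function (fun t : config N => spin t j : R).
Proof. by move=> t; rewrite /spin; case: (t j); [right; rewrite expr1|left; rewrite expr0]. Qed.

Lemma mixture_le (x y : R) : 0 <= x <= y -> xi.[x] <= xi.[y].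
Proof.
move=> /andP[x0 xy]; rewrite !mixtureE; apply: ler_sum => k _.
by rewrite ler_wpM2l ?sqr_ge0// lerXn2r// nnegrE; exact: le_trans xy.
Qed.

(* The linear field [f h t = \sum_j h_j t_j] is bounded on a slice through
   [h_j t_j = (h_j s_j + k) s_j t_j - k s_j t_j]: a Lagrange multiplier for the
   overlap constraint. *)
Lemma max_exp_slice_le (s : config N) (ql qu k : R) (h : 'I_N -> R) : 0 <= k ->
  max_exp (overlap_slice s ql qu) (fun t => \sum_(j < N) h j * spin t j) <=
  expR (- (k * N%:R * ql)) * \prod_(j < N) expR `|h j * spin s j + k|.
Proof.
move=> k0; rewrite -expR_sum -expRD.
apply: max_exp_le; first exact: expR_ge0.
move=> t; rewrite inE => /andP[qlt _]; rewrite ler_expR.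
have {}qlt : ql * N%:R <= inner s t by rewrite -ler_pdivlMr// ltr0n.
have -> : \sum_(j < N) h j * spin t j =
    \sum_(j < N) (h j * spin s j + k) * (spin s j * spin t j) - k * inner s t.
  rewrite /inner mulr_sumr -sumrB; apply: eq_bigr => j _.
  have ss : spin s j * spin s j = 1 :> R by rewrite -expr2 spin_sqr.
  by transitivity (h j * (spin s j * spin s j) * spin t j); [rewrite ss mulr1|ring].
rewrite addrC lerD//.
  by rewrite lerN2 -mulrA [N%:R * ql]mulrC ler_wpM2l.
apply: ler_sum => j _; apply: le_trans (ler_norm _) _; rewrite normrM.
have -> : `|spin s j * spin t j| = 1 :> R.
  have [->|->] := spin_sign j s; have [->|->] := spin_sign j t;
  by rewrite ?mulr1 ?mulrN1 ?opprK ?normrN normr1.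
by rewrite mulr1.
Qed.

Local Open Scope ereal_scope.

(** After the comparison with a linear field, the sites are independent and each contributes at most
    [exp m], by the assumed one-dimensional bound. *)
Lemma averages_linear_slice (s : config N) (ql qu lam b m : R) :
  (0 <= lam)%R -> (0 <= b)%R ->
  \int[gam]_x (expR (lam * Num.sqrt (xi^`()).[1] * `|x - b|))%:E <= (expR m)%:E ->
  averages [seq (fun t => lam * (str w * spin_product t w))%R | w <- l]
    (EFin \o max_exp (overlap_slice s ql qu)) (fun=> 0%R) <=
  (expR (- (lam * Num.sqrt (xi^`()).[1] * b * N%:R * ql) + N%:R * m))%:E.
Proof.
move=> lam0 b0 Im; set A := overlap_slice s ql qu.
set sig := Num.sqrt _ in Im *; have sig0 : (0 <= sig)%R by exact: sqrtr_ge0.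
(* The multiplier is scaled so that each site sees [lam * sig * |x - b|], up to the reflection
   [x -> - x] when the planted spin is 1. *)
pose k := (lam * sig * b)%R; have k0 : (0 <= k)%R by rewrite !mulr_ge0.
have nF := max_exp_nonneg A (R := R).
pose f (h : 'I_N -> R) (t : config N) : R := (\sum_(j < N) h j * spin t j)%R.
pose L := flatten [seq [seq ((lam * str w)%R, j) | j <- w] | w <- l].
have -> : [seq (fun t => lam * (str w * spin_product t w))%R | w <- l] =
    [seq (fun t => (lam * str w) * \prod_(j <- w) spin t j)%R | w <- l].
  by apply: eq_map => w; apply/funext => t; rewrite mulrA.
have wne w : w \in l -> w != [::].
  by move=> /mem_interactions; case: w.
apply: (le_trans (@averages_sign_words R _ A _ (fun w => lam * str w)%R
  (fun j t => spin t j) l (fun=> 0%R) spin_sign wne)).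
have -> : flatten [seq [seq (fun t : config N => lam * str w * spin t j)%R | j <- w] | w <- l] =
    map f [seq coordinate p.1 p.2 | p <- L].
  rewrite -map_comp /L; elim: (interactions P N) => //= w l' IH.
  rewrite map_cat IH -map_comp; congr (_ ++ _).
  apply: eq_map => j /=; apply/funext => t; rewrite /f (bigD1 j)//= big1 ?addr0; last first.
    by move=> i /negPf ij; rewrite /coordinate ij mulr0 mul0r.
  by rewrite /coordinate eqxx mulr1.
rewrite (_ : (fun=> 0%R) = f (fun=> 0%R)); last first.
  by apply/funext => t; rewrite /f big1// => j _; rewrite mul0r.
rewrite averages_comp; last first.
  move=> e a x; apply/funext => t; rewrite /f /move_along mulr_sumr -big_split.
  by apply: eq_bigr => j _; rewrite mulrDl mulrA.
pose theta (j : 'I_N) (y : R) : \bar R := (expR `|y * spin s j + k|)%:E.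
have ntheta j : nonneg_measurable_real (theta j).
  apply: nonneg_measurable_expR; apply: measurableT_comp => //.
  by apply: measurable_funD => //; exact: measurable_funM.
have nS := smooth_product_nonneg ntheta.
pose K := expR (- (k * N%:R * ql)); have K0 : (0 <= K)%R by exact: expR_ge0.
have nFf : nonneg_functional ((EFin \o max_exp A) \o f).
  split=> [d T g mg|e]; last exact: nF.2.
  apply: nF.1 => t; apply: measurable_sum => j.
  exact: measurable_funM.
apply: (@le_trans _ _ (averages [seq coordinate p.1 p.2 | p <- L]
    (fun h => K%:E * smooth_product theta (fun=> 0%R) h) (fun=> 0%R))).
  apply: le_averages => //; first exact: nonneg_functionalM (nonneg_functional_cst K0) (nS _).
  move=> h; apply: (@le_trans _ _ (K * \prod_(j < N) expR `|h j * spin s j + k|)%:E).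
    by rewrite lee_fin; exact: max_exp_slice_le.
  rewrite EFinM lee_wpmul2l ?lee_fin// le_eqVlt; apply/orP; left; apply/eqP.
  rewrite /smooth_product -prodEFin; apply: eq_bigr => j _.
  by rewrite sqrtr0 gaussian_smooth0.
rewrite averagesZ// averages_smooth_product//.
rewrite expRD EFinM; apply: lee_wpmul2l; first by rewrite lee_fin.
rewrite /smooth_product.
(* The variance accumulated at a site is the weighted degree of that site, scaled by [lam^2]. *)
have V (i : 'I_N) : (0 + \sum_(p <- L | p.2 == i) p.1 ^+ 2 = (lam * sig) ^+ 2)%R.
  rewrite add0r /L big_flatten big_map.
  transitivity (\sum_(w <- l) lam ^+ 2 * (str w ^+ 2 * (count_mem i w)%:R))%R.
    apply: eq_bigr => w _; rewrite big_map /= -big_filter big_const_seq.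
    by rewrite count_predT size_filter iter_addr_0 -[LHS]mulr_natr; ring.
  rewrite -mulr_sumr interactions_degree// exprMn sqr_sqrtr//.
  rewrite mixture_deriv1 sumr_ge0// => j _; rewrite mulr_ge0 ?sqr_ge0//.
have smooth (j : 'I_N) : gaussian_smooth (lam * sig) (theta j) 0 <= (expR m)%:E.
  apply: le_trans Im; rewrite /gaussian_smooth /theta.
  have nd : @nonneg_measurable R _ (measurableTypeR R) (fun x => (expR (lam * sig * `|x - b|))%:E).
    apply: nonneg_measurable_expR; apply: measurable_funM => //.
    by apply: measurableT_comp => //; exact: measurable_funB.
  have [sj|sj] := spin_sign j s; last first.
    rewrite le_eqVlt; apply/orP; left; apply/eqP; apply: eq_integral => x _.
    rewrite sj add0r /k; congr (expR _)%:E.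
    rewrite mulrN1 addrC -mulrBr normrM ger0_norm ?mulr_ge0//.
    by rewrite distrC.
  rewrite -(ge0_integral_std_normal_oppr nd.1 nd.2).
  rewrite le_eqVlt; apply/orP; left; apply/eqP; apply: eq_integral => x _.
  rewrite sj add0r mulr1 /k -mulrDr normrM ger0_norm ?mulr_ge0//.
  by rewrite -opprD normrN.
apply: (@le_trans _ _ (\prod_(j < N) (expR m)%:E)); last first.
  by rewrite prodEFin prodr_const card_ord expRM_natl.
suff [] : 0 <= \prod_(j < N) gaussian_smooth
      (Num.sqrt (0 + \sum_(p <- L | p.2 == j) p.1 ^+ 2)%R) (theta j) 0%R /\
    \prod_(j < N) gaussian_smooth
      (Num.sqrt (0 + \sum_(p <- L | p.2 == j) p.1 ^+ 2)%R) (theta j) 0%R <=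
    \prod_(j < N) (expR m)%:E by [].
elim/big_rec2: _ => [|j y x _ [x0 xy]]; first by [].
have s0 := (gaussian_smooth_nonneg (lam * sig)%R (ntheta j)).2 0%R.
rewrite V sqrtr_sqr ger0_norm ?mulr_ge0//; split; first exact: mule_ge0.
exact: lee_pmul.
Qed.

(** The part of each direction not depending on [t] is the tilt by the weight of [s]: it costs
    [N beta^2 xi(1) / 2] and shifts the field at [t] by [beta lam N xi(<s, t> / N)]. Since
    [ql >= 0], monotonicity of [xi] on nonnegative overlaps bounds this shift on the slice by its
    value at [qu]. *)
Lemma planted_bound (s : config N) (beta ql qu lam b m : R) :
  (0 <= beta)%R -> (0 <= lam)%R -> (0 <= b)%R -> (0 <= ql)%R ->
  \int[gam]_x (expR (lam * Num.sqrt (xi^`()).[1] * `|x - b|))%:E <= (expR m)%:E ->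
  averages [seq (fun t => str w * (beta * spin_product s w + lam * spin_product t w))%R | w <- l]
    (EFin \o max_exp (overlap_slice s ql qu)) (fun=> 0%R) <=
  (expR (N%:R * (beta ^+ 2 * xi.[1] / 2 + beta * lam * xi.[qu]
     - lam * Num.sqrt (xi^`()).[1] * b * ql + m)))%:E.
Proof.
move=> beta0 lam0 b0 ql0 Im; set A := overlap_slice s ql qu.
have nF := max_exp_nonneg A (R := R).
pose bb w := (beta * (str w * spin_product s w))%R.
pose a w (t : config N) := (lam * (str w * spin_product t w))%R.
have -> : [seq (fun t => str w * (beta * spin_product s w + lam * spin_product t w))%R | w <- l] =
    [seq (fun t => bb w + a w t)%R | w <- l].
  by apply: eq_map => w; apply/funext => t; rewrite /bb /a; ring.
rewrite (averages_tilt _ _ _ _ nF (max_exp_homogeneous A (R := R))).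
have -> : (\sum_(w <- l) bb w ^+ 2 / 2 = N%:R * (beta ^+ 2 * xi.[1] / 2))%R.
  rewrite -[RHS]mulrCA -[in RHS]mulrA.
  transitivity (beta ^+ 2 / 2 * \sum_(w <- l) str w ^+ 2)%R.
    rewrite mulr_sumr; apply: eq_bigr => w _.
    by rewrite /bb !exprMn spin_product_sqr mulr1; ring.
  by rewrite interactions_variance//; ring.
pose h (t : config N) := (\sum_(w <- l) bb w * a w t)%R.
pose K := (N%:R * (beta * lam * xi.[qu]))%R.
have hE t : h t = (beta * lam * (N%:R * xi.[inner s t / N%:R]))%R.
  rewrite -interactions_overlap// mulr_sumr; apply: eq_bigr => w _.
  by rewrite /bb /a; ring.
have hA t : t \in A -> (h t <= K)%R.
  rewrite inE => /andP[h1 h2]; rewrite hE /K [leRHS]mulrCA ler_wpM2l ?mulr_ge0//.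
  rewrite ler_wpM2l// mixture_le// h2 andbT; exact: le_trans h1.
have := averages_shift (map a l) (EFin \o max_exp A) h (fun=> 0%R).
rewrite (_ : (fun c => 0 + \sum_(i <- l) bb i * a i c)%R = ((fun=> 0) \+ h)%R)// => ->.
rewrite 3!mulrDr -!addrA expRD EFinM; apply: lee_wpmul2l; first by rewrite lee_fin expR_ge0.
rewrite expRD EFinM -/K.
have nFh : nonneg_functional (fun e' => (EFin \o max_exp A) (e' \+ h)%R).
  split=> [d T g mg|e]; last exact: nF.2.
  by apply: nF.1 => t; apply: measurable_funD.
apply: (@le_trans _ _ (averages (map a l) (fun e => (expR K)%:E * (EFin \o max_exp A) e) (fun=> 0%R))).
  apply: le_averages => //.
    exact: nonneg_functionalM (nonneg_functional_cst (expR_ge0 K)) nF.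
  move=> e; rewrite -EFinM lee_fin; apply: max_exp_le.
    by rewrite mulr_ge0 ?expR_ge0 ?max_exp_ge0.
  move=> t tA; rewrite /= addrC expRD; apply: ler_pM; rewrite ?expR_ge0//.
    by rewrite ler_expR hA.
  exact: max_exp_ge.
rewrite averagesZ ?expR_ge0//; apply: lee_wpmul2l; first by rewrite lee_fin expR_ge0.
apply: le_trans (averages_linear_slice s ql qu lam0 b0 Im) _.
rewrite lee_fin ler_expR le_eqVlt; apply/orP; left; apply/eqP; ring.
Qed.

End planted_bound.

(** The integral of a nonnegative function is a supremum over the simple functions below it, hence
    monotone. The Gibbs weight of the random event and the positive part of [ln Z] are thus bounded
    directly by functionals of known measurability. *)
Lemma ge0_le_integral_nonmeasurable d (T : measurableType d) (R : realType)
    (mu : {measure set T -> \bar R}) (f g : T -> \bar R) :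
  (forall x, 0 <= f x)%E -> (forall x, f x <= g x)%E ->
  (\int[mu]_x f x <= \int[mu]_x g x)%E.
Proof.
move=> f0 fg; have g0 x : (0 <= g x)%E by exact: le_trans (fg x).
rewrite !ge0_integralTE//; apply: ub_ereal_sup => _ [h hf <-].
by apply: ereal_sup_ubound; exists h => // x; exact: le_trans (hf x) (fg x).
Qed.

(** * Bounds at fixed [N] *)

Section finite_size.
Context {R : realType} (P : nat) (gamma : nat -> R) (N : nat).
Hypothesis N0 : (0 < N)%N.
Local Notation l := (interactions P N).
Local Notation str := (interaction_strength gamma).
Local Notation xi := (mixture P gamma).
Local Notation ham := (hamiltonian P gamma).

(** If [Z <= exp u], the Gibbs weight is at most 1 and the first term, a Chernoff weight for small
    [Z], is at least 1. Otherwise [1 / Z <= exp (- u)], and each [s] in the event has a partner [t]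
    in its slice with [exp (lam (H t - beta xi(1) N)) >= 1]. *)
Lemma gibbs_overlap_le (g : seq 'I_N -> R) (beta ql qu lam lam1 u : R) :
  0 <= lam -> 0 <= lam1 -> 0 <= u ->
  gibbs P gamma g beta (overlap_event P gamma g beta ql qu) <=
  expR (lam1 * (u + 1)) * expR (- lam1 * log_sum_exp (fun t => beta * ham g t)) +
  expR (- u) * (expR (- (lam * beta * xi.[1] * N%:R)) *
    \sum_(s : config N) max_exp (overlap_slice s ql qu)
      (fun t => beta * ham g s + lam * ham g t)).
Proof.
move=> lam0 lam10 u0; set Z := sum_exp (fun t => beta * ham g t).
have Z0 : 0 < Z.
  by rewrite /Z /sum_exp (bigD1 [ffun=> true])//= ltr_pwDl ?expR_gt0// sumr_ge0.
have M0 (s : config N) : 0 <= max_exp (overlap_slice s ql qu)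
      (fun t => beta * ham g s + lam * ham g t) by exact: max_exp_ge0.
have R0 : 0 <= expR (- u) * (expR (- (lam * beta * xi.[1] * N%:R)) *
    \sum_(s : config N) max_exp (overlap_slice s ql qu)
      (fun t => beta * ham g s + lam * ham g t)).
  by rewrite mulr_ge0 ?expR_ge0// mulr_ge0 ?expR_ge0// sumr_ge0.
rewrite /gibbs -/(sum_exp _) -[partition_function P gamma g beta]/Z.
have [Zu|uZ] := leP Z (expR u).
  apply: ler_wpDr => //; apply: (@le_trans _ _ 1).
    rewrite -mulr_suml ler_pdivrMr// mul1r /Z /sum_exp [leRHS](bigID (mem (overlap_event P gamma g beta ql qu)))/=.
    by rewrite lerDl sumr_ge0// => s _; exact: expR_ge0.
  rewrite -expRD -[leLHS]expR0 ler_expR mulNr -mulrBr mulr_ge0// subr_ge0.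
  rewrite /log_sum_exp -[leRHS]expRK ler_ln ?posrE ?expR_gt0//; last by rewrite ltr_pwDl// ltW.
  (* The [+ 1] in [u + 1] pays for [ln (1 + Z)]: [1 + Z <= 2 exp u <= exp (u + 1)]. *)
  have e1 : 2 <= expR 1 :> R by have := expR_ge1Dx (1 : R); lra.
  have eu : 1 <= expR u by rewrite -expR0 ler_expR.
  rewrite -/Z expRD; have := expR_gt0 u; nra.
apply: ler_wpDl; first by rewrite mulr_ge0 ?expR_ge0.
rewrite -mulr_suml mulrC.
apply: (@le_trans _ _ (expR (- u) * \sum_(s in overlap_event P gamma g beta ql qu) expR (beta * ham g s))).
  by rewrite ler_wpM2r ?sumr_ge0// ?expRN ?lef_pV2 ?posrE ?expR_gt0// ?ltW.
rewrite ler_wpM2l ?expR_ge0// mulr_sumr big_mkcond/=.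
apply: ler_sum => s _; case: ifP => [|_]; last by rewrite mulr_ge0 ?expR_ge0.
rewrite inE => /existsP[t /andP[Ht st]].
apply: (@le_trans _ _ (expR (- (lam * beta * xi.[1] * N%:R)) * expR (beta * ham g s + lam * ham g t))).
  rewrite -expRD ler_expR addrCA lerDl.
  by rewrite addrC subr_ge0 -!mulrA ler_wpM2l// mulrA.
rewrite ler_wpM2l ?expR_ge0//; apply: (max_exp_ge (fun t => beta * ham g s + lam * ham g t)).
by rewrite inE.
Qed.

Local Open Scope ereal_scope.

Lemma expectation_interactions (G : disorder R P N) (a : seq 'I_N -> config N -> R)
    (F : (config N -> R) -> \bar R) : nonneg_functional F ->
  \int[disorder_prob G]_w F (fun t => \sum_(i <- l) coupling G i w * a i t)%R =
  averages [seq a i | i <- l] F (fun=> 0%R).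
Proof.
move=> nF; rewrite -(ge0_expectation_averages (coupling_iid G))//; last 2 first.
- exact: uniq_interactions.
- by move=> j /mem_interactions.
by apply: eq_integral => w _; congr F; apply/funext => t; rewrite add0r.
Qed.

Definition scaled_interactions (r : R) : seq (config N -> R) :=
  [seq (fun t : config N => r * (str w * spin_product t w))%R | w <- l].

Lemma scaled_hamiltonianE (g : seq 'I_N -> R) (r : R) (t : config N) :
  (r * ham g t = \sum_(w <- l) g w * (r * (str w * spin_product t w)))%R.
Proof. by rewrite hamiltonianE mulr_sumr; apply: eq_bigr => w _; rewrite mulrCA. Qed.

Lemma expected_gibbs_overlap_le (G : disorder R P N) (beta ql qu lam lam1 u : R) :
  (0 <= lam)%R -> (0 <= lam1)%R -> (0 <= u)%R ->
  expected_gibbs_overlap gamma G beta ql qu <=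
  (expR (lam1 * (u + 1)))%:E *
    averages (scaled_interactions beta) (fun e => (expR (- lam1 * log_sum_exp e))%:E) (fun=> 0%R) +
  (expR (- u) * expR (- (lam * beta * xi.[1] * N%:R)))%:E *
    \sum_(s : config N) averages
      [seq (fun t => str w * (beta * spin_product s w + lam * spin_product t w))%R | w <- l]
      (EFin \o max_exp (overlap_slice s ql qu)) (fun=> 0%R).
Proof.
move=> lam0 lam10 u0; rewrite /expected_gibbs_overlap unlock.
set mu := disorder_prob G.
pose F1 (e : config N -> R) : \bar R := (expR (- lam1 * log_sum_exp e))%:E.
have nF1 : nonneg_functional F1 by exact: (nonneg_functional_expR (- lam1)%R log_sum_exp_nonneg).
have nF2 (s : config N) := max_exp_nonneg (overlap_slice s ql qu) (R := R).
pose f1 w := F1 (fun t => beta * ham (fun i => coupling G i w) t)%R.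
pose f2 s w := (EFin \o max_exp (overlap_slice s ql qu))
  (fun t => beta * ham (fun i => coupling G i w) s + lam * ham (fun i => coupling G i w) t)%R.
have mham (t : config N) : measurable_fun [set: disorder_space G] (fun w => ham (fun i => coupling G i w) t).
  rewrite (_ : (fun w => _) = (fun w => \sum_(i <- l) coupling G i w * (str i * spin_product t i))%R); last first.
    by apply/funext => w; rewrite hamiltonianE.
  by apply: measurable_sum => i; exact: measurable_funM.
have n1 : nonneg_measurable f1.
  split; last by move=> w; exact: nF1.2.
  by apply: nF1.1 => t; exact: measurable_funM.
have n2 s : nonneg_measurable (f2 s).
  split; last by move=> w; exact: (nF2 s).2.
  by apply: (nF2 s).1 => t; apply: measurable_funD; exact: measurable_funM.
have n3 : nonneg_measurable (fun w => \sum_(s : config N) f2 s w).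
  split; last by move=> w; apply: sume_ge0 => s _; exact: (n2 s).2.
  by apply: emeasurable_sum => s; exact: (n2 s).1.
have K1 : 0 <= (expR (lam1 * (u + 1)))%:E by rewrite lee_fin expR_ge0.
have K2 : 0 <= (expR (- u) * expR (- (lam * beta * xi.[1] * N%:R)))%:E.
  by rewrite lee_fin mulr_ge0 ?expR_ge0.
apply: (@le_trans _ _ (\int[mu]_w ((expR (lam1 * (u + 1)))%:E * f1 w +
   (expR (- u) * expR (- (lam * beta * xi.[1] * N%:R)))%:E * \sum_(s : config N) f2 s w))).
  apply: ge0_le_integral_nonmeasurable => w.
    rewrite lee_fin /gibbs sumr_ge0// => s _; rewrite divr_ge0 ?expR_ge0//.
    by rewrite sumr_ge0// => t _; exact: expR_ge0.
  rewrite /f1 /f2 /F1 sumEFin -!EFinM -EFinD lee_fin -(mulrA (expR (- u))).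
  exact: gibbs_overlap_le.
rewrite (integral_nonneg_measurableD mu (nonneg_measurableZ K1 n1) (nonneg_measurableZ K2 n3)).
rewrite (integral_nonneg_measurableZl mu K1 n1) (integral_nonneg_measurableZl mu K2 n3).
rewrite ge0_integral_sum//; last 2 first.
- by move=> s; exact: (n2 s).1.
- by move=> s w _; exact: (n2 s).2.
have E r w : (fun t => r * ham (fun i => coupling G i w) t)%R =
    (fun t => \sum_(i <- l) coupling G i w * (r * (str i * spin_product t i)))%R.
  by apply/funext => t; exact: scaled_hamiltonianE.
have -> : \int[mu]_w f1 w = averages (scaled_interactions beta) F1 (fun=> 0%R).
  rewrite -(expectation_interactions G _ nF1).
  by apply: eq_integral => w _; rewrite /f1 E.
rewrite (eq_bigr (fun s => averages
  [seq (fun t => str w * (beta * spin_product s w + lam * spin_product t w))%R | w <- l]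
  (EFin \o max_exp (overlap_slice s ql qu)) (fun=> 0%R)))// => s _.
rewrite -(expectation_interactions G _ (nF2 s)); apply: eq_integral => w _; rewrite /f2.
suff -> : (fun t => beta * ham (fun i => coupling G i w) s + lam * ham (fun i => coupling G i w) t)%R =
  (fun t => \sum_(i <- l) coupling G i w * (str i * (beta * spin_product s i + lam * spin_product t i)))%R by [].
apply/funext => t; rewrite !scaled_hamiltonianE -big_split; apply: eq_bigr => i _ /=.
by ring.
Qed.

Lemma expectation_ln_partition_le (G : disorder R P N) (beta : R) :
  'E_(disorder_prob G)[fun w => ln (partition_function P gamma (fun i => coupling G i w) beta)] <=
  averages (scaled_interactions beta) (EFin \o log_sum_exp) (fun=> 0%R).
Proof.
(* The negative part of [ln Z] only lowers the expectation and is dropped; the positive part is at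
   most [ln (1 + Z)]. *)
rewrite unlock integralE -[leRHS]sube0; apply: leeB; last by apply: integral_ge0.
rewrite -(expectation_interactions G _ (log_sum_exp_nonneg (R := R))).
apply: ge0_le_integral_nonmeasurable => w; first by [].
rewrite funeposE ge_max; apply/andP; split; last first.
  by rewrite lee_fin log_sum_exp_ge0.
rewrite lee_fin /log_sum_exp.
have -> : (fun t => \sum_(i <- l) coupling G i w * (beta * (str i * spin_product t i)))%R =
    (fun t => beta * ham (fun i => coupling G i w) t)%R.
  by apply/funext => t; rewrite scaled_hamiltonianE.
have Z0 : (0 < partition_function P gamma (fun i => coupling G i w) beta)%R.
  by rewrite /partition_function (bigD1 [ffun=> true])//= ltr_pwDl ?expR_gt0// sumr_ge0.
by rewrite ler_ln ?posrE ?ltr_pwDl ?sum_exp_ge0// lerDr.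
Qed.

(** Going down from [bc] to [beta] lowers the mean of [ln (1 + Z)] by at most the difference of the
    annealed exponents, so a nearly annealed mean at [bc] stays so at [beta]. Concentration then
    uses the total variance [beta^2 N xi(1)]. *)
Lemma averages_log_sum_exp_laplace (beta bc a lam1 : R) :
  (0 <= lam1)%R -> (0 <= beta <= bc)%R ->
  a%:E <= averages (scaled_interactions bc) (EFin \o log_sum_exp) (fun=> 0%R) ->
  averages (scaled_interactions beta) (fun e => (expR (- lam1 * log_sum_exp e))%:E) (fun=> 0%R) <=
  (expR (- lam1 * (a - (bc ^+ 2 - beta ^+ 2) / 2 * (N%:R * xi.[1])) +
     lam1 ^+ 2 * (beta ^+ 2 * (N%:R * xi.[1]))))%:E.
Proof.
move=> lam10 /andP[beta0 bbc] ha.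
pose F := EFin \o log_sum_exp : (config N -> R) -> \bar R.
have nF : nonneg_functional F by exact: log_sum_exp_nonneg.
have LF : lipschitz_functional F by exact: log_sum_exp_lipschitz.
have sq w (t : config N) : ((str w * spin_product t w) ^+ 2 = str w ^+ 2)%R.
  by rewrite exprMn spin_product_sqr mulr1.
have nm w (t : config N) : (`|str w * spin_product t w| = `|str w|)%R.
  by rewrite -(sqrtr_sqr (str w * _)) sq sqrtr_sqr.
have bnd i (c : config N) : i \in l -> (`|beta * (str i * spin_product c i)| <= beta * `|str i|)%R.
  by move=> _; rewrite normrM nm ger0_norm.
have k0 (i : seq 'I_N) : (0 <= beta * `|str i|)%R by rewrite mulr_ge0.
have H1 := averages_log_subgaussian_scale (fun=> 0%R) (introT andP (conj beta0 bbc)) nF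
  (log_sum_exp_log_subgaussian (R := R)) (fun i c (_ : i \in l) => sq i c).
have LB := averages_lipschitz nF bnd LF.
have nB := averages_nonneg (scaled_interactions beta) nF.
have H2 := averages_concentration (fun=> 0%R) lam10 k0 nF bnd LF.
apply: (le_trans H2); rewrite lee_fin ler_expR; apply: lerD.
  rewrite !mulNr lerN2 ler_wpM2l// lerBlDr -lee_fin EFinD (lipschitz_fineK _ nB LB).
  by apply: (le_trans ha); move: H1; rewrite interactions_variance.
rewrite ler_wpM2l ?sqr_ge0// le_eqVlt; apply/orP; left; apply/eqP.
rewrite -interactions_variance// mulr_sumr; apply: eq_bigr => w _.
by rewrite exprMn real_normK// num_real.
Qed.

End finite_size.

(** * Lower bound on the free energy at the critical temperature *)

Section annealed.
Context {R : realType} (P : nat) (gamma : nat -> R).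
Local Notation xi := (mixture P gamma).

(* Without any realization of the disorder every temperature would be annealed. *)
Lemma disorder_inhabited (bc : R) : is_beta_c P gamma bc ->
  forall N, exists G : disorder R P N, True.
Proof.
move=> [_ ub] N; apply: contrapT => noG.
have : annealed_temperatures P gamma (bc + 1).
  by move=> G; exfalso; apply: noG; exists (G N).
by move=> /ub; rewrite gerDl ler10.
Qed.

Lemma free_energy_lower (bc e : R) : is_beta_c P gamma bc -> 0 < e ->
  \forall N \near \oo, forall G : disorder R P N,
    ((bc ^+ 2 * xi.[1] / 2 + ln 2 - e)%:E <= free_energy gamma G bc)%E.
Proof.
move=> hbc e0; have inh := disorder_inhabited hbc.
set y := bc ^+ 2 * xi.[1] / 2 + ln 2.
pose bad N (G : disorder R P N) := ~ ((y - e)%:E <= free_energy gamma G bc)%E.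
(* Choosing a worst realization for each N turns the pointwise convergence
   into a bound uniform in the realization. *)
have worst N : exists G : disorder R P N, (exists G' : disorder R P N, bad N G') -> bad N G.
  have [[G' bG']|nob] := pselect (exists G' : disorder R P N, bad N G'); first by exists G'.
  by have [G _] := inh N; exists G.
pose G N : disorder R P N := projT1 (cid (worst N)).
have /fine_cvgP[fin cv] := hbc.1 G.
have ly : y - e < y by rewrite ltrBlDr ltrDl.
have ev : \forall N \near \oo, y - e <= fine (free_energy gamma (G N) bc).
  by apply: (cvgr_ge y) => //; exact: cv.
near=> N => G'; apply: contrapT => bG'.
have : bad N (G N) by apply: (projT2 (cid (worst N))); exists G'.
apply; have finN : free_energy gamma (G N) bc \is a fin_num by near: N.
rewrite -(fineK finN) lee_fin; near: N.
exact: ev.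
Unshelve. all: by end_near. Qed.

End annealed.

(** * Choice of the overlap and of the width of its window *)

Section choice_of_parameters.
Context {R : realType} (P : nat) (gamma : nat -> R).
Local Notation xi := (mixture P gamma).
Local Notation sig := (Num.sqrt (xi^`()).[1]).

Lemma beta_d_bar_witness (beta : R) :
  (exists2 k : nat, (2 <= k <= P)%N & gamma k != 0) -> beta_d_bar P gamma < beta ->
  0 < beta /\ exists q b : R, [/\ 0 < q < 1, 0 <= b, 2^-1 < Phi b, 2 * Phi b - 1 = q &
    2 * sig * normal_pdf 0 1 b < beta * (xi.[1] - xi.[q])].
Proof.
move=> hg; rewrite /beta_d_bar; set E := (X in inf X) => infE.
have xilt q : 0 < q < 1 -> 0 < xi.[1] - xi.[q].
  move=> /andP[q0 q1]; have [k /andP[k2 kP] gk] := hg.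
  rewrite !mixtureE -sumrB (bigD1_seq k) ?iota_uniq ?mem_index_iota ?k2 ?ltnS//=.
  rewrite ltr_pwDl ?sumr_ge0// => [|i _]; rewrite -mulrBr expr1n.
    rewrite mulr_gt0 ?exprn_even_gt0// subr_gt0 exprn_ilt1 ?ltW//.
    by case: (k) k2.
  by rewrite mulr_ge0 ?sqr_ge0// subr_ge0 exprn_ile1// ltW.
have E0 : lbound E 0.
  move=> _ [q /= q01 <-]; rewrite in_itv/= in q01.
  by rewrite divr_ge0// ?mulr_ge0 ?sqrtr_ge0 ?normal_pdf_ge0// ltW// xilt.
(* The value at overlap 1/2 shows that the set is nonempty, as required by the bounds on its
   infimum. *)
have Eh : E (2 * sig * normal_pdf 0 1 (Phi_inv ((1 + 2^-1) / 2)) / (xi.[1] - xi.[2^-1])).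
  by exists 2^-1 => //=; rewrite in_itv/= invr_gt0 ltr0n invf_lt1 ?ltr1n.
have b0 : 0 < beta by apply: le_lt_trans infE; apply: lb_le_inf => //; exists (2 * sig * normal_pdf 0 1 (Phi_inv ((1 + 2^-1) / 2)) / (xi.[1] - xi.[2^-1])).
split=> //.
have hE : has_inf E by split; [exists (2 * sig * normal_pdf 0 1 (Phi_inv ((1 + 2^-1) / 2)) / (xi.[1] - xi.[2^-1]))|exists 0].
have e0 : 0 < beta - inf E by rewrite subr_gt0.
have [_ [q /= q01 <-]] := inf_adherent e0 hE.
rewrite subrKC => lt_beta; rewrite in_itv/= in q01.
have /andP[q0 q1] := q01.
have y01 : 0 < (1 + q) / 2 < 1 by apply/andP; split; lra.
have PK := Phi_invK y01.
have half : 2^-1 < Phi (Phi_inv ((1 + q) / 2)) by rewrite PK; lra.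
exists q, (Phi_inv ((1 + q) / 2)); split=> //.
- exact: Phi_gt_half.
- by rewrite PK; field.
- by rewrite -ltr_pdivrMr// xilt.
Qed.

(** The left side is the loss due to the window: the planted covariance is taken at [q + h], the
    multiplier term at [q - h]. It is a polynomial in [h] vanishing at 0. *)
Lemma overlap_window (q b beta d : R) : 0 < q < 1 -> 0 < d ->
  exists h : R, [/\ 0 < h, 0 < q - h, q + h < 1 &
    beta * (xi.[q + h] - xi.[q]) + sig * b * h <= d].
Proof.
move=> /andP[q0 q1] d0.
pose p : {poly R} := (beta *: (xi \Po (q%:P + 'X) - (xi.[q])%:P) + (sig * b) *: 'X).
have pE h : p.[h] = beta * (xi.[q + h] - xi.[q]) + sig * b * h.
  by rewrite /p !hornerE horner_comp !hornerE.
have p0 : p.[0] = 0 by rewrite pE addr0 subrr !mulr0 addr0.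
have cp : p.[x] @[x --> 0^'+] --> p.[0].
  by apply: cvg_at_right_filter; exact: continuous_horner.
near (0 : R)^'+ => h.
exists h; rewrite -pE; split.
- near: h; exact: nbhs_right_gt.
- by rewrite subr_gt0; near: h; exact: nbhs_right_lt.
- by rewrite -ltrBrDl; near: h; apply: nbhs_right_lt; rewrite subr_gt0.
- by near: h; apply: (cvgr_le _ cp); rewrite p0.
Unshelve. all: by end_near. Qed.

End choice_of_parameters.

(** * Choice of constants and conclusion *)

Theorem theorem1p3 (R : realType) (P : nat) (gamma : nat -> R)
    (hP : (2 <= P)%N)
    (hgamma : exists2 k : nat, (2 <= k <= P)%N & gamma k != 0)
    (beta beta_c : R) (hbeta_c : is_beta_c P gamma beta_c)
    (hbeta_d : beta_d_bar P gamma < beta) (hbeta : beta < beta_c) :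
  exists ql qu c : R,
    [/\ 0 < ql, ql < qu, qu < 1, 0 < c &
      \forall N \near \oo, forall G : disorder R P N,
        (expected_gibbs_overlap gamma G beta ql qu
           <= (expR (- c * N%:R))%:E)%E].
Proof.
set xi := mixture P gamma.
have [beta0 [q [b [q01 b0 Pb Pq hq]]]] := beta_d_bar_witness hgamma hbeta_d.
set sig := Num.sqrt _ in hq; have sig0 : 0 <= sig by exact: sqrtr_ge0.
set phi := normal_pdf 0 1 b in hq.
(* The gain [lam * d] is spent in quarters: on the window, on the second-order term in [lam], on the
   lowered threshold for [Z], and on the final rate. *)
pose d := beta * (xi.[1] - xi.[q]) - 2 * sig * phi.
have d0 : 0 < d by rewrite subr_gt0.
have [h [h0 qh0 qh1 hd]] : exists h : R, [/\ 0 < h, 0 < q - h, q + h < 1 &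
    beta * (xi.[q + h] - xi.[q]) + sig * b * h <= d / 4].
  by apply: overlap_window => //; rewrite divr_gt0.
have [K K0 HK] := integral_expR_dist_std_normal Pb.
(* The first bound gives [lam * sig <= 1], the range of the expansion [HK]; the second keeps its
   quadratic term below a quarter of the gain. *)
pose lam := Num.min (sig + 1)^-1 (d / (4 * (K * sig ^+ 2 + 1))).
have s1 : 0 < sig + 1 by rewrite ltr_wpDl.
have Ks1 : 0 < K * sig ^+ 2 + 1 by rewrite ltr_wpDl// mulr_ge0// sqr_ge0.
have lam0 : 0 < lam by rewrite lt_min invr_gt0 s1 divr_gt0// mulr_gt0.
have lamsig : 0 <= lam * sig <= 1.
  apply/andP; split; first by rewrite mulr_ge0// ltW.
  apply: (@le_trans _ _ ((sig + 1)^-1 * sig)).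
    by rewrite ler_wpM2r// ge_min lexx.
  by rewrite mulrC ler_pdivrMr// mul1r lerDl.
have lamK : K * lam * sig ^+ 2 <= d / 4.
  have : lam * (K * sig ^+ 2 + 1) <= d / 4.
    rewrite -ler_pdivlMr//; apply: (@le_trans _ _ (d / (4 * (K * sig ^+ 2 + 1)))).
      by rewrite ge_min lexx orbT.
    by rewrite invfM mulrA.
  by nra.
have xi1 : 0 <= xi.[1] by rewrite /xi mixtureE sumr_ge0// => k _; rewrite mulr_ge0 ?sqr_ge0// expr1n.
pose ann := beta ^+ 2 * xi.[1] / 2 + ln 2.
have ln20 : 0 < ln 2 :> R by rewrite ln_gt0// ltr1n.
have ann_ge : ln 2 <= ann by rewrite lerDr divr_ge0// mulr_ge0// sqr_ge0.
(* The first bound makes [3 e] at most a quarter of the gain; the second makes the threshold [u]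
   nonnegative. *)
pose e := Num.min (lam * d / 12) (ln 2 / 3).
have e0 : 0 < e by rewrite lt_min !divr_gt0// mulr_gt0.
have e1 : 3 * e <= lam * d / 4.
  have : e <= lam * d / 12 by rewrite ge_min lexx.
  by lra.
have e2 : 3 * e <= ann.
  have : e <= ln 2 / 3 by rewrite ge_min lexx orbT.
  by lra.
pose B := beta ^+ 2 * xi.[1]; have B0 : 0 <= B by rewrite mulr_ge0 ?sqr_ge0.
(* Makes the variance cost [lam1 * B] of the concentration bound at most [e / 2]. *)
pose lam1 := e / (2 * (B + 1)).
have B1 : 0 < B + 1 by rewrite ltr_wpDl.
have lam10 : 0 < lam1 by rewrite divr_gt0// mulr_gt0.
have lam1B : lam1 * B <= e / 2.
  have : lam1 * (B + 1) = e / 2 by rewrite /lam1; field; rewrite gt_eqF.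
  by nra.
pose c := Num.min (lam1 * e / 2) (lam * d / 4).
have c0 : 0 < c by rewrite lt_min; apply/andP; split; rewrite divr_gt0// mulr_gt0.
exists (q - h), (q + h), (c / 2); split=> //.
- by lra.
- by rewrite divr_gt0.
near=> N => G.
have N0 : (0 < N)%N by near: N; exact: nbhs_infty_gt.
have Ne : 1 <= N%:R * e.
  by rewrite -ler_pdivrMr// mul1r; near: N; exact: nbhs_infty_ger.
have Nc : ln 2 <= N%:R * (c / 2).
  by rewrite -ler_pdivrMr ?divr_gt0//; near: N; exact: nbhs_infty_ger.
have NR0 : 0 < N%:R :> R by rewrite ltr0n.
have FE : ((beta_c ^+ 2 * xi.[1] / 2 + ln 2 - e)%:E <= free_energy gamma G beta_c)%E.
  by move: G; near: N; exact: free_energy_lower.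
pose a := N%:R * (beta_c ^+ 2 * xi.[1] / 2 + ln 2 - e).
have ha : (a%:E <= averages (scaled_interactions P gamma N beta_c)
    (EFin \o log_sum_exp) (fun=> 0%R))%E.
  apply: le_trans (expectation_ln_partition_le gamma G beta_c).
  by move: FE; rewrite /free_energy lee_pdivlMl.
(* One [e] covers the error in the free energy, one absorbs the additive 1 in [u + 1], and the last
   one, less the variance cost, leaves the rate [e / 2]. *)
pose u := N%:R * (ann - 3 * e).
have u0 : 0 <= u by rewrite mulr_ge0 ?subr_ge0// ltW.
apply: le_trans (expected_gibbs_overlap_le gamma G beta (q - h) (q + h) (ltW lam0) (ltW lam10) u0) _.
have bbc : 0 <= beta <= beta_c by rewrite !ltW.
have H1 := averages_log_sum_exp_laplace N0 (ltW lam10) bbc ha.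
have H2 s := planted_bound N0 s (q + h) (ltW beta0) (ltW lam0) b0 (ltW qh0) (HK _ lamsig).
have cN1 : c <= lam1 * e / 2 by rewrite ge_min lexx.
have cN2 : c <= lam * d / 4 by rewrite ge_min lexx orbT.
have T1 : ((expR (lam1 * (u + 1)))%:E * averages (scaled_interactions P gamma N beta)
    (fun e => (expR (- lam1 * log_sum_exp e))%:E) (fun=> 0%R) <= (expR (- (N%:R * c)))%:E)%E.
  apply: (@le_trans _ _ ((expR (lam1 * (u + 1)))%:E * (expR (- lam1 *
    (a - (beta_c ^+ 2 - beta ^+ 2) / 2 * (N%:R * xi.[1])) +
     lam1 ^+ 2 * (beta ^+ 2 * (N%:R * xi.[1]))))%:E)%E).
    by apply: lee_wpmul2l => //; rewrite lee_fin expR_ge0.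
  rewrite -EFinM -expRD lee_fin ler_expR.
  have -> : lam1 * (u + 1) + (- lam1 * (a - (beta_c ^+ 2 - beta ^+ 2) / 2 * (N%:R * xi.[1])) +
      lam1 ^+ 2 * (beta ^+ 2 * (N%:R * xi.[1]))) =
      lam1 * (1 - N%:R * e - N%:R * (e - lam1 * B)).
    by rewrite /u /a /ann /B; field.
  apply: (@le_trans _ _ (lam1 * (- (N%:R * (e / 2))))).
    apply: ler_wpM2l; first exact: ltW.
    have : N%:R * (e / 2) <= N%:R * (e - lam1 * B) by apply: ler_wpM2l; [exact: ltW|lra].
    by lra.
  rewrite mulrN lerN2 mulrCA; apply: ler_wpM2l; first exact: ltW.
  by rewrite mulrA.
have T2 : ((expR (- u) * expR (- (lam * beta * xi.[1] * N%:R)))%:E *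
    \sum_(s : config N) averages
      [seq (fun t => interaction_strength gamma w *
        (beta * spin_product s w + lam * spin_product t w))%R | w <- interactions P N]
      (EFin \o max_exp (overlap_slice s (q - h) (q + h))) (fun=> 0%R) <= (expR (- (N%:R * c)))%:E)%E.
  pose E2 := N%:R * (beta ^+ 2 * xi.[1] / 2 + beta * lam * xi.[q + h] -
    lam * sig * b * (q - h) + (lam * sig * (2 * phi + b * (2 * Phi b - 1)) + K * (lam * sig) ^+ 2)).
  apply: (@le_trans _ _ ((expR (- u) * expR (- (lam * beta * xi.[1] * N%:R)))%:E *
    \sum_(s : config N) (expR E2)%:E)%E).
    apply: lee_wpmul2l; first by rewrite lee_fin mulr_ge0 ?expR_ge0.
    by apply: lee_sum => s _; exact: H2.
  rewrite sumEFin sumr_const card_ffun card_bool card_ord -EFinM lee_fin.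
  have -> : expR E2 *+ (2 ^ N) = expR (N%:R * ln 2 + E2).
    by rewrite expRD expRM_natl lnK ?posrE ?ltr0n// -natrX mulr_natl.
  (* The number [2^N] of planted configurations and the tilt cost cancel the annealed part of [u].
     By the choice of [b], the terms [b q] from the mean of [|g - b|] and from the multiplier cancel
     as well, leaving [b h]. *)
  rewrite -!expRD ler_expR /E2 Pq.
  have -> : - u - lam * beta * xi.[1] * N%:R + (N%:R * ln 2 + N%:R *
      (beta ^+ 2 * xi.[1] / 2 + beta * lam * xi.[q + h] - lam * sig * b * (q - h) +
       (lam * sig * (2 * phi + b * q) + K * (lam * sig) ^+ 2))) =
      N%:R * (3 * e + lam * (- d + (beta * (xi.[q + h] - xi.[q]) + sig * b * h) + K * lam * sig ^+ 2)).
    by rewrite /u /ann /d; field.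
  rewrite -mulrN; apply: ler_wpM2l; first exact: ltW.
  have : lam * (- d + (beta * (xi.[q + h] - xi.[q]) + sig * b * h) + K * lam * sig ^+ 2) <= lam * (- d / 2).
    by apply: ler_wpM2l; [exact: ltW|lra].
  by lra.
(* Halving the rate absorbs the factor 2 from the two terms. *)
apply: le_trans (leeD T1 T2) _; rewrite -EFinD lee_fin -mulr2n.
have -> : expR (- (N%:R * c)) *+ 2 = expR (ln 2 - N%:R * c).
  by rewrite expRD lnK ?posrE ?ltr0n// (mulr_natl _ 2).
by rewrite ler_expR; lra.
Unshelve. all: by end_near. Qed.
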